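(* Let $P=[p_{i,j}]$ be the transition matrix of an irreducible and aperiodic $M$-state Markov chain with stationary distribution $\pi$, let $\beta>0$, and let $y_{m,n}$ ($1\le m\le M$, $n\ge1$) be i.i.d. $\mathcal{N}(0,1)$ random variables (this is the null hypothesis $\mathcal{H}_0$, with expectation $\mathbb{E}_0$). Let $D_n=e^{-\beta^2/2}\operatorname{diag}\big(e^{\beta y_{1,n}},\dots,e^{\beta y_{M,n}}\big)$. Then the Kullback-Leibler divergence rate $$\kappa=-\lim_{N\to\infty}\frac1N\,\mathbb{E}_0\log\big(\pi^T D_1 P D_2 P\cdots P D_N\mathbf{1}\big)$$ exists. Further, under $\mathcal{H}_0$ the normalized log likelihood ratio converges almost surely: $$\lim_{N\to\infty}\frac1N\log\big(\pi^T D_1 P D_2 P\cdots P D_N\mathbf{1}\big)=-\kappa\quad\text{almost surely},$$ and thus it converges in probability.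
   Context: $\mathbf{1}$ is the all-ones column vector in $\mathbb{R}^M$. $\pi^T D_1 P D_2\cdots P D_N\mathbf{1}$ is the likelihood ratio $L(Y^N)=P_1(Y^N)/P_0(Y^N)$ between the hypothesis $\mathcal{H}_1$ (a hidden path $s_1,\dots,s_N$ is drawn from the stationary Markov chain $P$; given the path, the $y_{m,n}$ are independent, $\mathcal{N}(\beta,1)$ if $m=s_n$ and $\mathcal{N}(0,1)$ otherwise) and the hypothesis $\mathcal{H}_0$ (all $y_{m,n}$ i.i.d. $\mathcal{N}(0,1)$). *)

(* Defs.v *)
From HB Require Import structures.
From mathcomp Require Export all_boot all_order all_algebra.
From mathcomp Require Export all_classical all_reals all_analysis.
Export Order.TTheory GRing.Theory Num.Theory.
Export numFieldNormedType.Exports.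

Set Implicit Arguments.
Unset Strict Implicit.
Unset Printing Implicit Defensive.

Local Open Scope classical_set_scope.
Local Open Scope ring_scope.

Section MarkovChains.
Context {R : realType} {M : nat}.
Implicit Types (P : 'M[R]_M) (mu : 'cV[R]_M).

Definition stochastic_matrix P :=
  (forall i j, 0 <= P i j) /\ (forall i, \sum_j P i j = 1).

Definition irreducible_chain P :=
  forall i j, exists n : nat, 0 < (P ^+ n) i j.

(* Every state has period 1: any common divisor of the positive lengths of its
   closed walks is 1. A state with no return has every d as a common divisor,
   hence is not aperiodic. *)
Definition aperiodic_chain P :=
  forall i (d : nat),
    (forall n : nat, (0 < n)%N -> 0 < (P ^+ n) i i -> (d %| n)%N) -> d = 1%N.

Definition stationary_distribution P mu :=
  [/\ forall i, 0 <= mu i 0, \sum_i mu i 0 = 1 & mu^T *m P = mu^T].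

End MarkovChains.

Section RandomVariables.
Context {d : measure_display} {T : measurableType d} {R : realType}.
Variable Pr : probability T R.

Definition mutually_independent (I : eqType) (J : set I)
    (X : I -> {RV Pr >-> R}) :=
  forall (s : seq I) (B : I -> set R),
    uniq s -> [set` s] `<=` J -> (forall i, measurable (B i)) ->
    Pr (\bigcap_(i in [set` s]) (X i @^-1` B i)) =
    (\prod_(i <- s) Pr (X i @^-1` B i))%E.

(* The second parameter of [normal_prob] is the standard deviation. *)
Definition standard_gaussian (X : {RV Pr >-> R}) :=
  forall B : set R, measurable B -> distribution Pr X B = normal_prob 0 1 B.

Definition cvg_in_probability (X : nat -> T -> R) (l : R) :=
  forall eps : R, 0 < eps ->
    Pr [set w | eps <= `|X N w - l|] @[N --> \oo] --> 0%E.

End RandomVariables.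

Section LikelihoodRatio.
Context {R : realType} {M : nat}.

Definition obs_matrix (beta : R) (y : 'I_M -> R) : 'M[R]_M :=
  expR (- (beta ^+ 2 / 2)) *: diag_mx (\row_m expR (beta * y m)).

(* mu^T D_1 P D_2 P ... P D_N 1, for N >= 1; [y m n] is the observation at
   state m and time n, times starting at 1. *)
Definition likelihood_ratio (P : 'M[R]_M) (mu : 'cV[R]_M) (beta : R)
    (y : 'I_M -> nat -> R) (N : nat) : R :=
  let D n := obs_matrix beta (y ^~ n) in
  (mu^T *m (D 1%N *m \prod_(2 <= n < N.+1) (P *m D n))
    *m (const_mx 1 : 'cV[R]_M)) 0 0.

End LikelihoodRatio.

(* Main.v *)
From HB Require Import structures.
Require Import Defs.
From mathcomp Require Import measurable_realfun ring lra zify.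
Local Open Scope classical_set_scope.
Local Open Scope ring_scope.

(* Write L_N for the likelihood ratio. Some power P^r has all its entries at
   least delta > 0, so after r steps the forward filter forgets its initial law
   up to a constant factor. As mu is stationary, log L is therefore almost
   additive: log L_{n+k} - log L_n - (log L_k) o shift^n is bounded by a random
   variable depending only on the r observations that follow time n. Taking
   expectations, E log L_N is almost additive, hence E log L_N = N l + O(1).
   Since log L_n and (log L_n) o shift^n are independent with the same law, the
   second moment q of log L_N - N l satisfies q_{2n} <= 5/2 q_n + K, which gives
   q_N = O(N^{3/2}); Chebyshev's inequality yields convergence in probability,
   and summability along N = j^4, with the gaps controlled by the sizes of the
   observations, yields almost sure convergence. *)

Set Implicit Arguments.
Unset Strict Implicit.
Unset Printing Implicit Defensive.

(** * Primitive stochastic matrices *)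

(** Independence plays the part of an ergodic theorem. The shifted term log L_k o shift^n restarts
    from mu, so it is a function of the observations after time n alone; the cross moment of the two
    centred halves is therefore the product of their means. Centring is at N l and not at the
    expectation, so these means do not vanish, but they are bounded by a constant and cost only a
    constant. The defect of additivity is correlated with the second half; it enters through its
    second moment alone, by Young's inequality, and this inflates the factor 2 of additive variances
    to 5/2. The exponent 3/2 then fixes the subsequence: the square of (log L_N - N l) / N has mean
    O(N^{-1/2}), which is O(j^{-2}) at N = j^4, and gaps of length O(j^3) between fourth powers are
    also O(j^{-2}) after division by j^4 and squaring. *)

Lemma additive_closed_eventually (S : nat -> Prop) :
  (forall m n, S m -> S n -> S (m + n)%N) ->
  (forall d, (forall n, (0 < n)%N -> S n -> (d %| n)%N) -> d = 1%N) ->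
  exists N, forall n, (N <= n)%N -> S n.
Proof.
move=> SD Sgcd.
have SM k n : (0 < k)%N -> S n -> S (k * n)%N.
  case: k => // k _ Sn; elim: k => [|k IHk]; first by rewrite mul1n.
  by rewrite mulSn; exact: SD.
have [n0 n0_gt0 Sn0] : exists2 n, (0 < n)%N & S n.
  apply: contrapT => noS; suff: 2%N = 1%N by [].
  by apply: Sgcd => n n0 Sn; exfalso; apply: noS; exists n.
(* The least difference [e] between two members divides every positive member [n]: otherwise
   [n %/ e * (s + e)] and [n %/ e * s + n] would differ by the smaller [n %% e]. Hence [e] is 1. *)
pose gap e := `[< exists s, [/\ (0 < s)%N, (0 < e)%N, S s & S (s + e)%N] >].
have gap_ex : exists e, gap e.
  by exists n0; apply/asboolP; exists n0; split=> //; exact: SD.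
case: (ex_minnP gap_ex) => e /asboolP[s [s0 e0 Ss Sse]] e_min.
have e1 : e = 1%N.
  apply: Sgcd => n n_gt0 Sn; apply: contrapT => /negP ndvd.
  have r0 : (0 < n %% e)%N by rewrite lt0n -/(e %| n)%N.
  have : (n %% e < e)%N by rewrite ltn_mod.
  rewrite ltnNge => /negP; apply; apply: e_min; apply/asboolP.
  have [q0|q0] := posnP (n %/ e).
    exists n; split => //; rewrite {2}(divn_eq n e) q0 in Sn *.
    by rewrite (_ : (n %% e)%N = n) in r0 *; [exact: SD|lia].
  exists (n %/ e * (s + e))%N; split => //; [by rewrite muln_gt0 q0; lia|exact: SM|].
  have -> : (n %/ e * (s + e) + n %% e = n %/ e * s + n)%N.
    by rewrite {4}(divn_eq n e); lia.
  by apply: SD => //; exact: SM.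
rewrite {}e1 addn1 in Sse.
exists (s * s)%N => n ssn.
have rs : (n %% s < s)%N by rewrite ltn_mod.
have sq : (s <= n %/ s)%N by rewrite leq_divRL.
(* With [s] and [s.+1] in [S], trade [n %% s] of the copies of [s] for copies of [s.+1]; there are
   enough of them once [n >= s * s]. *)
have -> : n = ((n %/ s - n %% s) * s + n %% s * s.+1)%N.
  rewrite {1}(divn_eq n s) mulnBl mulnS addnA addnAC subnK //.
  by rewrite leq_mul2r (leq_trans (ltnW rs) sq) orbT.
have Sqs : S ((n %/ s - n %% s) * s)%N by apply: SM => //; lia.
have [r0|r0] := posnP (n %% s); first by rewrite {2}r0 mul0n addn0.
by apply: SD => //; exact: SM.
Qed.

Section primitive.
Context {R : realType} {M : nat}.
Variable P : 'M[R]_M.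
Hypothesis P_ge0 : forall i j, 0 <= P i j.

Lemma exprmx_ge0 n i j : 0 <= (P ^+ n) i j.
Proof.
elim: n i j => [|n IHn] i j; first by rewrite expr0 mxE; case: (_ == _).
by rewrite exprS mxE; apply: sumr_ge0 => k _; rewrite mulr_ge0.
Qed.

Lemma exprmxD_gt0 m n i j k :
  0 < (P ^+ m) i j -> 0 < (P ^+ n) j k -> 0 < (P ^+ (m + n)) i k.
Proof.
move=> Pij Pjk; rewrite exprD mxE (bigD1 j) //= ltr_wpDr ?mulr_gt0 //.
by apply: sumr_ge0 => l _; rewrite mulr_ge0 ?exprmx_ge0.
Qed.

Lemma primitive_power : irreducible_chain P -> aperiodic_chain P ->
  exists (r : nat) (delta : R),
    [/\ 0 < delta, delta <= 1 & forall i j, delta <= (P ^+ r) i j].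
Proof.
move=> irr aper.
have /choice[N NP] : forall i, exists N, forall n, (N <= n)%N -> 0 < (P ^+ n) i i.
  move=> i; apply: additive_closed_eventually; last exact: aper.
  by move=> m n; exact: exprmxD_gt0.
have /choice[l lP] : forall ij : 'I_M * 'I_M, exists n, 0 < (P ^+ n) ij.1 ij.2.
  by move=> [i j]; exact: irr.
(* One length for all pairs: loop at [i] for [r - l (i, j)] steps, which is at least [N i], then
   follow the chosen path to [j]. *)
pose r := (\max_i N i + \max_ij l ij)%N.
have Pr_gt0 i j : 0 < (P ^+ r) i j.
  have lr : (l (i, j) <= \max_ij l ij)%N by exact: leq_bigmax.
  have Nr : (N i <= \max_i N i)%N by exact: leq_bigmax.
  rewrite -(@subnK (l (i, j)) r); last by rewrite (leq_trans lr) ?leq_addl.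
  by apply: exprmxD_gt0 (lP (i, j)); apply: NP; rewrite /r; lia.
(* Starting the minimum at 1 ensures [delta <= 1], so that [- ln delta] is a nonnegative error
   term. *)
exists r, (\big[Num.min/1]_(ij : 'I_M * 'I_M) (P ^+ r) ij.1 ij.2); split.
- by elim/big_rec : _ => // ij x _ x0; rewrite lt_min Pr_gt0.
- by apply: bigmin_le_id.
- by move=> i j; exact: (bigmin_le_cond 1 (fun ij => (P ^+ r) ij.1 ij.2) (j := (i, j))).
Qed.

End primitive.

(** * The forward filter *)

Section forward_filter.
Context {R : realType} {M : nat}.
Variable P : 'M[R]_M.
Implicit Types (b : nat -> 'I_M -> R) (u v : 'rV[R]_M).

(** The unnormalized forward recursion of a hidden Markov model. Without normalization it is linear
    and monotone in [u], and the likelihood is its total mass. *)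
Fixpoint forward b u n : 'rV[R]_M :=
  if n is n'.+1 then \row_m ((forward b u n' *m P) 0 m * b n' m) else u.

Definition mass u := \sum_i u 0 i.

Lemma forwardS b u n m :
  forward b u n.+1 0 m = (forward b u n *m P) 0 m * b n m.
Proof. by rewrite /= mxE. Qed.

Lemma forwardD b u n k :
  forward b u (n + k) = forward (fun j => b (n + j)%N) (forward b u n) k.
Proof. by elim: k => [|k IHk]; rewrite ?addn0 // addnS /= IHk. Qed.

Lemma forwardZ b u c n : forward b (c *: u) n = c *: forward b u n.
Proof.
elim: n => // n IHn; apply/rowP => m.
by rewrite /= IHn -scalemxAl !mxE mulrA.
Qed.

Lemma massZ c u : mass (c *: u) = c * mass u.
Proof. by rewrite /mass mulr_sumr; apply: eq_bigr => i _; rewrite mxE. Qed.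

Hypothesis P_stochastic : stochastic_matrix P.
Let P_ge0 := P_stochastic.1.
Let P_sum1 := P_stochastic.2.

Lemma mass_mulmx u : mass (u *m P) = mass u.
Proof.
rewrite /mass; under eq_bigr do rewrite mxE.
by rewrite exchange_big /=; apply: eq_bigr => i _; rewrite -mulr_sumr P_sum1 mulr1.
Qed.

Lemma mass_mulmx_exp u n : mass (u *m P ^+ n) = mass u.
Proof.
elim: n => [|n IHn]; first by rewrite expr0 mulmx1.
by rewrite exprSr -mulmxE mulmxA mass_mulmx.
Qed.

Lemma le_mulmx u v : (forall m, u 0 m <= v 0 m) ->
  forall m, (u *m P) 0 m <= (v *m P) 0 m.
Proof. by move=> uv m; rewrite !mxE; apply: ler_sum => i _; rewrite ler_wpM2r. Qed.

Lemma le_forward b u v n : (forall j m, 0 < b j m) ->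
  (forall m, u 0 m <= v 0 m) -> forall m, forward b u n 0 m <= forward b v n 0 m.
Proof.
move=> b_gt0 uv; elim: n => // n IHn m.
by rewrite !forwardS ler_wpM2r ?(ltW (b_gt0 _ _)) ?le_mulmx.
Qed.

Lemma forward_ge0 b u n : (forall j m, 0 < b j m) ->
  (forall m, 0 <= u 0 m) -> forall m, 0 <= forward b u n 0 m.
Proof.
move=> b_gt0 u0; elim: n => // n IHn m; rewrite forwardS mulr_ge0 ?(ltW (b_gt0 _ _)) //.
by rewrite mxE sumr_ge0 // => i _; rewrite mulr_ge0.
Qed.

Section bounds.
Variables (b : nat -> 'I_M -> R) (h : nat -> R).
Hypothesis b_gt0 : forall j m, 0 < b j m.
Hypothesis b_ub : forall j m, b j m <= expR (h j).
Hypothesis b_lb : forall j m, expR (- h j) <= b j m.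

(** Replacing each weight by its extreme values leaves the unweighted chain, with law
    [u *m P ^+ n]. *)
Lemma forward_bounds u n : (forall m, 0 <= u 0 m) -> forall m,
  expR (- \sum_(j < n) h j) * (u *m P ^+ n) 0 m <= forward b u n 0 m /\
  forward b u n 0 m <= expR (\sum_(j < n) h j) * (u *m P ^+ n) 0 m.
Proof.
move=> u_ge0; elim: n => [|n IHn] m.
  by rewrite big_ord0 oppr0 expR0 !mul1r expr0 mulmx1.
have uPn k : 0 <= (u *m P ^+ n) 0 k.
  by rewrite mxE sumr_ge0 // => i _; rewrite mulr_ge0 ?exprmx_ge0.
have uPS k : 0 <= (u *m P ^+ n *m P) 0 k.
  by rewrite mxE sumr_ge0 // => i _; rewrite mulr_ge0.
have IHl k : (expR (- \sum_(j < n) h j) *: (u *m P ^+ n)) 0 k <= forward b u n 0 k.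
  by rewrite mxE (IHn k).1.
have IHu k : forward b u n 0 k <= (expR (\sum_(j < n) h j) *: (u *m P ^+ n)) 0 k.
  by rewrite mxE (IHn k).2.
have {}IHl := le_mulmx IHl m; have {}IHu := le_mulmx IHu m.
rewrite -scalemxAl mxE in IHl; rewrite -scalemxAl [leRHS]mxE in IHu.
rewrite forwardS big_ord_recr /= opprD !expRD exprSr -mulmxE mulmxA.
have FP : 0 <= (forward b u n *m P) 0 m.
  by apply: le_trans IHl; rewrite mulr_ge0 ?expR_ge0.
by split; rewrite mulrAC; apply: ler_pM => //;
  rewrite ?mulr_ge0 ?expR_ge0 ?(ltW (b_gt0 _ _)).
Qed.

Lemma mass_forward_bounds u n : (forall m, 0 <= u 0 m) ->
  expR (- \sum_(j < n) h j) * mass u <= mass (forward b u n) /\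
  mass (forward b u n) <= expR (\sum_(j < n) h j) * mass u.
Proof.
move=> u0; rewrite -(mass_mulmx_exp u n) /mass !mulr_sumr.
by split; apply: ler_sum => m _; have [] := forward_bounds n u0 m.
Qed.

Lemma mass_forward_gt0 u n : (forall m, 0 <= u 0 m) -> mass u = 1 ->
  0 < mass (forward b u n).
Proof.
move=> u0 u1; apply: lt_le_trans (mass_forward_bounds n u0).1.
by rewrite u1 mulr1 expR_gt0.
Qed.

Lemma norm_ln_mass_forward u n : (forall m, 0 <= u 0 m) -> mass u = 1 ->
  `|ln (mass (forward b u n))| <= \sum_(j < n) h j.
Proof.
move=> u0 u1; have [] := mass_forward_bounds n u0; rewrite u1 !mulr1 => lb ub.
have mgt0 := mass_forward_gt0 n u0 u1.
by rewrite ler_norml -ler_expR -[X in _ && X]ler_expR lnK ?posrE // lb ub.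
Qed.

(* After [r] steps the filter has forgotten its initial law up to a constant
   factor, because [P ^+ r] has all its entries in [delta, 1]. *)
Lemma forward_forgets (r : nat) (delta : R) u v k :
  0 < delta -> delta <= 1 -> (forall i j, delta <= (P ^+ r) i j) ->
  (forall m, 0 <= u 0 m) -> mass u = 1 -> (forall m, 0 <= v 0 m) -> mass v = 1 ->
  (forall j, 0 <= h j) ->
  ln (mass (forward b u k)) <=
    ln (mass (forward b v k)) + (2 * (\sum_(j < r) h j) - ln delta).
Proof.
move=> delta0 delta1 Pdelta u0 u1 v0 v1 h0.
have [kr|rk] := leqP k r.
  have := norm_ln_mass_forward k u0 u1; have := norm_ln_mass_forward k v0 v1.
  rewrite !ler_norml => /andP[lv _] /andP[_ lu].
  have hkr : \sum_(j < k) h j <= \sum_(j < r) h j.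
    by rewrite -!(big_mkord xpredT) (big_cat_nat _ kr) //= lerDl sumr_ge0.
  have : ln delta <= 0 by rewrite ln_le0.
  lra.
have -> : 2 * (\sum_(j < r) h j) - ln delta =
    ln (expR (2 * (\sum_(j < r) h j)) / delta).
  by rewrite ln_div ?posrE ?expR_gt0 // expRK.
(* At time [r] the runs compare entrywise: [u *m P ^+ r] is at most 1 and [v *m P ^+ r] at least
   [delta], while removing the weights from both costs [expR (2 * H)] with [H] the sum of the [h j].
   Linearity and monotonicity carry the comparison from [r] to [k]. *)
set c := _ / _; have c0 : 0 < c by rewrite divr_gt0 ?expR_gt0.
have mu0 := mass_forward_gt0 k u0 u1; have mv0 := mass_forward_gt0 k v0 v1.
rewrite -lnM ?posrE // ler_ln ?posrE //; last exact: mulr_gt0.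
rewrite [leRHS]mulrC -massZ.
rewrite -forwardZ -(subnKC (ltnW rk)) !forwardD forwardZ; apply: ler_sum => m _.
rewrite -forwardZ; apply: le_forward => [j l|{}m]; first exact: b_gt0.
have [_ /le_trans -> //] := forward_bounds r u0 m.
rewrite forwardZ [leRHS]mxE; have [lv _] := forward_bounds r v0 m.
apply: (@le_trans _ _
  (c * (expR (- \sum_(j < r) h j) * (v *m P ^+ r) 0 m))); last first.
  by rewrite ler_wpM2l // ltW.
have P1 i j : (P ^+ r) i j <= 1.
  have <- : \sum_l (P ^+ r) i l = 1.
    have := mass_mulmx_exp (delta_mx 0 i) r; rewrite -rowE /mass.
    under eq_bigr do rewrite mxE; move=> ->.
    rewrite (bigD1 i) //= mxE !eqxx big1 ?addr0 // => l li.
    by rewrite mxE (negbTE li) andbF.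
  by rewrite (bigD1 j) //= lerDl sumr_ge0 // => l _; exact: exprmx_ge0.
have uP : (u *m P ^+ r) 0 m <= 1.
  by rewrite mxE -u1; apply: ler_sum => i _; rewrite ler_piMr.
have vP : delta <= (v *m P ^+ r) 0 m.
  by rewrite mxE -[delta]mul1r -v1 mulr_suml; apply: ler_sum => i _; rewrite ler_wpM2l.
rewrite /c expRM_natl expRN.
have e0 := expR_gt0 (\sum_(j < r) h j); move: e0; set e := expR _ => e0.
rewrite [leRHS](_ : _ = e * ((v *m P ^+ r) 0 m / delta)); last first.
  by field; rewrite !gt_eqF.
apply: ler_wpM2l; first exact: ltW.
by rewrite (le_trans uP) // ler_pdivlMr // mul1r.
Qed.

End bounds.
End forward_filter.

(** * Almost additivity of the log likelihood *)

Section log_likelihood.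
Context {R : realType} {M : nat}.
Variables (P : 'M[R]_M) (mu : 'cV[R]_M) (beta : R).
Implicit Type y : 'I_M -> nat -> R.

Definition obs_weight y (j : nat) (m : 'I_M) : R :=
  expR (- (beta ^+ 2 / 2)) * expR (beta * y m j).

(** A bound, uniform in the state, for the absolute value of the logarithm of [obs_weight y j m]. *)
Definition obs_size y (j : nat) : R := beta ^+ 2 / 2 + beta * \sum_m `|y m j|.

(* Times start at 0 here, hence the shift in [ln_likelihood_ratioE]. *)
Definition log_likelihood y N : R := ln (mass (forward P (obs_weight y) mu^T N)).

Hypothesis P_stochastic : stochastic_matrix P.
Hypothesis mu_stationary : stationary_distribution P mu.
Hypothesis beta_gt0 : 0 < beta.

Let mu_ge0 m : 0 <= mu^T 0 m.
Proof. by case: mu_stationary => + _ _; rewrite mxE; apply. Qed.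

Let mass_mu : mass mu^T = 1.
Proof. by case: mu_stationary => _ <- _; apply: eq_bigr => m _; rewrite mxE. Qed.

Let mulmx_mu : mu^T *m P = mu^T.
Proof. by case: mu_stationary. Qed.

(** The product starts with [D_1], whereas each step of [forward] starts with [P]; stationarity
    supplies the missing factor, which makes all times alike. The case [N = 0] is excluded because
    [likelihood_ratio] contains [D_1] even there. *)
Lemma likelihood_ratio_forward y N : (0 < N)%N ->
  likelihood_ratio P mu beta y N =
  mass (forward P (obs_weight (fun m j => y m j.+1)) mu^T N).
Proof.
case: N => // N _; rewrite /likelihood_ratio.
have obsE (v : 'rV[R]_M) n :
    v *m obs_matrix beta (y ^~ n.+1) =
    \row_m (v 0 m * obs_weight (fun m j => y m j.+1) n m).
  apply/rowP => m; rewrite /obs_matrix -scalemxAr mxE mul_mx_diag !mxE /obs_weight.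
  by rewrite mulrCA.
rewrite (_ : mu^T *m _ = forward P (obs_weight (fun m j => y m j.+1)) mu^T N.+1).
  by rewrite /mass mxE; apply: eq_bigr => m _; rewrite [X in _ * X]mxE mulr1.
elim: N => [|N IHN]; first by rewrite big_nil mulmx1 obsE /= mulmx_mu.
by rewrite big_nat_recr //= -mulmxE (mulmxA (obs_matrix _ _)) mulmxA IHN mulmxA obsE.
Qed.

Lemma ln_likelihood_ratioE y N : (0 < N)%N ->
  ln (likelihood_ratio P mu beta y N) = log_likelihood (fun m j => y m j.+1) N.
Proof. by move=> N_gt0; rewrite likelihood_ratio_forward. Qed.

Let weight_gt0 y j m : 0 < obs_weight y j m.
Proof. by rewrite mulr_gt0 ?expR_gt0. Qed.

Lemma obs_size_ge0 y j : 0 <= obs_size y j.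
Proof.
by rewrite addr_ge0 ?divr_ge0 ?sqr_ge0 // mulr_ge0 ?(ltW beta_gt0) // sumr_ge0.
Qed.

Let weight_bounds y j m :
  expR (- obs_size y j) <= obs_weight y j m /\ obs_weight y j m <= expR (obs_size y j).
Proof.
rewrite /obs_weight -expRD !ler_expR /obs_size.
have yl : `|y m j| <= \sum_m `|y m j| by rewrite (bigD1 m) //= lerDl sumr_ge0.
have : beta * `|y m j| <= beta * \sum_m `|y m j| by rewrite ler_wpM2l // ltW.
have := ler_norm (beta * y m j); have := ler_norm (- (beta * y m j)).
rewrite normrN normrM (gtr0_norm beta_gt0).
have : 0 <= beta ^+ 2 / 2 by rewrite divr_ge0 ?sqr_ge0.
by move: (beta ^+ 2 / 2) => ?; split; lra.
Qed.

Let weight_lb y j m := (weight_bounds y j m).1.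
Let weight_ub y j m := (weight_bounds y j m).2.

Lemma log_likelihood0 y : log_likelihood y 0 = 0.
Proof. by rewrite /log_likelihood /= mass_mu ln1. Qed.

Lemma norm_log_likelihood y N : `|log_likelihood y N| <= \sum_(j < N) obs_size y j.
Proof. exact: norm_ln_mass_forward. Qed.

(** The filter at time [n] is its mass times a probability vector [v]; by linearity the mass factors
    out, and the logarithm makes it a summand. *)
Let restart y n k : exists v : 'rV[R]_M,
  [/\ forall m, 0 <= v 0 m, mass v = 1 &
   log_likelihood y (n + k) = log_likelihood y n +
     ln (mass (forward P (obs_weight (fun m j => y m (n + j)%N)) v k))].
Proof.
pose c := mass (forward P (obs_weight y) mu^T n).
have c0 : 0 < c by exact: (mass_forward_gt0 P_stochastic (h := obs_size y)).
pose v := c^-1 *: forward P (obs_weight y) mu^T n.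
have v0 m : 0 <= v 0 m.
  by rewrite mxE mulr_ge0 ?invr_ge0 ?(ltW c0) //; exact: forward_ge0.
have v1 : mass v = 1 by rewrite massZ mulVf // gt_eqF.
exists v; split=> //; rewrite {1}/log_likelihood forwardD.
have -> : forward P (obs_weight y) mu^T n = c *: v.
  by rewrite scalerA divff ?scale1r // gt_eqF.
rewrite forwardZ massZ lnM ?posrE //.
exact: (mass_forward_gt0 P_stochastic (h := fun j => obs_size y (n + j))).
Qed.

Lemma log_likelihood_increment y n k :
  `|log_likelihood y (n + k) - log_likelihood y n| <= \sum_(j < k) obs_size y (n + j).
Proof.
have [v [v0 v1 ->]] := restart y n k; rewrite addrAC subrr add0r.
exact: (norm_ln_mass_forward P_stochastic (h := obs_size (fun m j => y m (n + j)%N))).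
Qed.

(** By [restart], this compares the runs from [v] and from the stationary law on the same [k]
    observations; [forward_forgets] is used in both directions. *)
Lemma log_likelihood_almost_additive (r : nat) (delta : R) y n k :
  0 < delta -> delta <= 1 -> (forall i j, delta <= (P ^+ r) i j) ->
  `|log_likelihood y (n + k) - log_likelihood y n
    - log_likelihood (fun m j => y m (n + j)%N) k| <=
  2 * (\sum_(j < r) obs_size y (n + j)) - ln delta.
Proof.
move=> delta0 delta1 Pdelta; have [v [v0 v1 ->]] := restart y n k.
rewrite [X in `|X - _|]addrAC subrr add0r ler_distl; apply/andP; split.
  rewrite lerBlDr.
  apply: (forward_forgets P_stochastic
    (h := obs_size (fun m j => y m (n + j)%N))) => // j.
  exact: obs_size_ge0.
apply: (forward_forgets P_stochastic
  (h := obs_size (fun m j => y m (n + j)%N))) => // j.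
exact: obs_size_ge0.
Qed.
End log_likelihood.

(** * Almost additive sequences and doubling recursions *)

Lemma almost_additive_linear {R : realType} (a : nat -> R) (g : R) :
  (forall n k, `|a (n + k)%N - a n - a k| <= g) ->
  exists l, forall n, `|a n - n%:R * l| <= g.
Proof.
move=> aD.
have aM n k : `|a (n.+1 * k)%N - n.+1%:R * a k| <= n.+1%:R * g.
  have g0 : 0 <= g by apply: le_trans (aD 0 0).
  elim: n => [|n IHn]; first by rewrite mul1n !mul1r subrr normr0.
  rewrite mulSn; have := aD k (n.+1 * k)%N; move: IHn.
  rewrite -[n.+2%:R]natr1 !mulrDl !mul1r !ler_norml => /andP[? ?] /andP[? ?].
  by apply/andP; split; lra.
(* Both [n * a k] and [k * a n] are close to [a (n * k)]. So every lower quotient lies below every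
   upper one, and the supremum of the lower ones separates the two families. *)
have aub n k : (0 < n)%N -> (0 < k)%N -> (a n - g) / n%:R <= (a k + g) / k%:R.
  case: n k => // n [] // k _ _; rewrite ler_pdivrMr // mulrAC ler_pdivlMr //.
  have := aM k n.+1; have := aM n k.+1; rewrite [(k.+1 * _)%N]mulnC !ler_norml.
  by move=> /andP[? ?] /andP[? ?]; lra.
pose S := [set (a n.+1 - g) / n.+1%:R | n in [set: nat]].
have Sne : S !=set0 by exists ((a 1%N - g) / 1%:R); exists 0%N.
have S_ub k : ubound S ((a k.+1 + g) / k.+1%:R) by move=> _ [n _ <-]; exact: aub.
exists (sup S) => -[|n].
  by have := aD 0 0; rewrite mul0r subrr sub0r subr0 normrN.
have lb : (a n.+1 - g) / n.+1%:R <= sup S.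
  by apply: ub_le_sup; [exists ((a 1%N + g) / 1%:R); exact: S_ub | exists n].
have ub : sup S <= (a n.+1 + g) / n.+1%:R by apply: ge_sup.
move: lb ub; rewrite ler_pdivrMr // ler_pdivlMr // => ? ?.
by rewrite ler_norml; apply/andP; split; lra.
Qed.

(* [5 / 2 < 2 ^ (3 / 2)], so [N ^ (3 / 2)] dominates the recursion. *)
Lemma doubling_growth {R : realType} (q : nat -> R) (K : R) :
  (forall n, (0 < n)%N -> q (2 * n)%N <= 5 / 2 * q n + K) ->
  (forall n, (0 < n)%N -> q (2 * n).+1 <= 5 / 2 * q n + K) ->
  exists2 A, 0 <= A & forall n, (0 < n)%N -> q n <= A * (n%:R * Num.sqrt n%:R).
Proof.
move=> q_even q_odd; pose A := Num.max 0 (Num.max (q 1%N) (4 * K)).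
have A0 : 0 <= A by rewrite le_max lexx.
have Aq1 : q 1%N <= A by rewrite !le_max lexx ?orbT.
have AK : 4 * K <= A by rewrite !le_max lexx ?orbT.
exists A => // n; elim/ltn_ind: n => n IHn n_gt0.
have [n1|n1] := leqP n 1.
  by have -> : n = 1%N; [lia|rewrite sqrtr1 !mulr1].
pose m := n./2; have m_gt0 : (0 < m)%N by rewrite /m; lia.
have qn : q n <= 5 / 2 * q m + K.
  have : n = (2 * m)%N \/ n = (2 * m).+1 by rewrite /m; lia.
  by case=> ->; [exact: q_even|exact: q_odd].
have qm : q m <= A * (m%:R * Num.sqrt m%:R) by apply: IHn => //; rewrite /m; lia.
have m1 : 1 <= m%:R :> R by rewrite ler1n.
have s1 : 1 <= Num.sqrt m%:R :> R by rewrite -[leLHS]sqrtr1 ler_sqrt ?ler0n.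
have n2m : 2 * m%:R <= n%:R :> R by rewrite -natrM ler_nat /m; lia.
(* [7 / 5] is a rational below the square root of 2. Then [2 * (7 / 5) = 14 / 5] exceeds [5 / 2] by
   more than [1 / 4], and this slack absorbs [K <= A / 4]. *)
have sn : 7 / 5 * Num.sqrt m%:R <= Num.sqrt n%:R :> R.
  rewrite (_ : 7 / 5 = Num.sqrt ((7 / 5) ^+ 2)); last by rewrite sqrtr_sqr ger0_norm.
  rewrite -sqrtrM ?sqr_ge0 // ler_sqrt ?ler0n //.
  by rewrite (le_trans _ n2m) // ler_wpM2r //; lra.
apply: (le_trans qn); have mm : 1 <= m%:R * Num.sqrt m%:R :> R by rewrite mulr_ege1.
have nn : 14 / 5 * (m%:R * Num.sqrt m%:R) <= n%:R * Num.sqrt n%:R :> R.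
  rewrite (_ : 14 / 5 * _ = (2 * m%:R) * (7 / 5 * Num.sqrt m%:R)); last by field.
  by apply: ler_pM => //; rewrite mulr_ge0 ?sqrtr_ge0.
apply: le_trans (ler_wpM2l A0 nn).
have : A * 1 <= A * (m%:R * Num.sqrt m%:R) by rewrite ler_wpM2l.
by move: qm; rewrite !mulr1 !(mulrCA A); lra.
Qed.

(** * Square-integrable functions *)

Lemma sum_inv_sqr_le {R : realType} n : \sum_(k < n) (k.+1%:R ^- 2 : R) <= 2.
Proof.
have [->|n_gt0] := posnP n; first by rewrite big_ord0.
(* The bound [2 - n^-1] telescopes, so it survives induction where the constant 2 would not. *)
apply: (@le_trans _ _ (2 - n%:R^-1)); last by rewrite lerBlDr lerDl invr_ge0 ler0n.
case: n n_gt0 => // n _; elim: n => [|n IHn].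
  by rewrite big_ord_recr big_ord0 /= expr1n invr1; lra.
rewrite big_ord_recr /=; apply: le_trans (lerD IHn (lexx _)) _.
have n0 : 0 < n.+1%:R :> R by rewrite ltr0n.
rewrite -[n.+2%:R]natr1; set x := n.+1%:R in n0 *.
rewrite -subr_ge0 (_ : _ - _ = (x * (x + 1) ^+ 2)^-1); last first.
  by field; rewrite !gt_eqF //; lra.
by rewrite invr_ge0 mulr_ge0 ?sqr_ge0 ?(ltW n0).
Qed.

Section ae_convergence.
Context d (T : measurableType d) (R : realType) (Pr : probability T R).

(** By monotone convergence the series of the [f n] has a finite integral, so it converges almost
    everywhere and its terms tend to 0. This does the work of a Borel-Cantelli argument. *)
Lemma ae_cvg0_of_summable_integrals (f : nat -> T -> R) (C : R) :
  (forall n, measurable_fun setT (f n)) -> (forall n w, 0 <= f n w) ->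
  (forall n, (\sum_(k < n) \int[Pr]_w (f k w)%:E <= C%:E)%E) ->
  {ae Pr, forall w, f n w @[n --> \oo] --> (0 : R)}.
Proof.
move=> mf f_ge0 fC.
pose F : T -> \bar R := fun w => (\sum_(0 <= n <oo) (f n w)%:E)%E.
have mF : measurable_fun setT F.
  apply: ge0_emeasurable_sum => // k; first by move=> w _ _; rewrite lee_fin.
  by move=> _; exact/measurable_EFinP.
have F_ge0 w : (0 <= F w)%E by apply: nneseries_ge0 => n _ _; rewrite lee_fin.
have intF : Pr.-integrable setT F.
  apply/integrableP; split=> //; under eq_integral do rewrite gee0_abs //.
  rewrite integral_nneseries //; last 2 first.
  - by move=> n; exact/measurable_EFinP.
  - by move=> n w _; rewrite lee_fin.
  apply: (@le_lt_trans _ _ C%:E); last exact: ltry.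
  apply: lime_le.
    apply: is_cvg_nneseries => n _ _; apply: integral_ge0 => w _.
    by rewrite lee_fin.
  by apply: nearW => n; rewrite big_mkord.
have := integrable_ae measurableT intF; apply: filterS => w /(_ Logic.I) Ffin.
apply: cvg_series_cvg_0; apply: nondecreasing_is_cvgn.
  by apply/nondecreasing_seqP => n; rewrite /series /= big_nat_recr //= lerDl.
exists (fine (F w)) => _ [n _ <-].
rewrite -lee_fin fineK // /series /= -sumEFin.
apply: nneseries_lim_ge => k _ _; by rewrite lee_fin.
Qed.

End ae_convergence.

Section square_integrable.
Context d (T : measurableType d) (R : realType) (Pr : probability T R).
Implicit Types f g : T -> R.

Definition square_integrable f :=
  measurable_fun setT f /\ Pr.-integrable setT (EFin \o (fun w => f w ^+ 2)).

Lemma le_integrable_real f g : measurable_fun setT f ->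
  Pr.-integrable setT (EFin \o g) -> (forall w, `|f w| <= g w) ->
  Pr.-integrable setT (EFin \o f).
Proof.
move=> mf ig fg; apply: (le_integrable measurableT _ _ ig).
  exact/measurable_EFinP.
by move=> w _; rewrite /= lee_fin (le_trans (fg w)) // ler_norm.
Qed.

Lemma square_integrable_le f g : measurable_fun setT f -> square_integrable g ->
  (forall w, `|f w| <= g w) -> square_integrable f.
Proof.
move=> mf [mg ig] fg; split=> //; apply: le_integrable_real ig _.
  exact: measurable_funX.
move=> w; rewrite normrX ler_sqr ?nnegrE //.
exact: le_trans (fg w).
Qed.

Lemma integrable_mul_square f g : square_integrable f -> square_integrable g ->
  Pr.-integrable setT (EFin \o (fun w => f w * g w)).
Proof.
move=> [mf if2] [mg ig2].
have := integrableD measurableT if2 ig2.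
rewrite (_ : (_ \+ _)%E = EFin \o (fun w => f w ^+ 2 + g w ^+ 2)); last first.
  by apply/funext => w /=; rewrite EFinD.
move=> int_sum; apply: le_integrable_real int_sum _; first exact: measurable_funM.
move=> w; rewrite normrM -(real_normK (num_real (f w))) -(real_normK (num_real (g w))).
move: (normr_ge0 (f w)) (normr_ge0 (g w)); nra.
Qed.

Lemma square_integrable_cst c : square_integrable (cst c).
Proof.
split; first exact: measurable_cst.
exact: (@finite_measure_integrable_cst _ _ _ Pr setT (c ^+ 2) measurableT).
Qed.

Lemma square_integrable_integrable f : square_integrable f ->
  Pr.-integrable setT (EFin \o f).
Proof.
move=> sf; have := integrable_mul_square sf (square_integrable_cst 1).
by congr (_.-integrable _ _); apply/funext => w /=; rewrite mulr1.
Qed.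

Lemma square_integrableD f g : square_integrable f -> square_integrable g ->
  square_integrable (fun w => f w + g w).
Proof.
move=> sf sg; have [[mf if2] [mg ig2]] := (sf, sg); split; first exact: measurable_funD.
have h1 := integrableD measurableT if2 ig2.
have h2 := integrableZl measurableT 2 (integrable_mul_square sf sg).
have := integrableD measurableT h1 h2.
congr (_.-integrable _ _); apply/funext => w /=.
by rewrite -EFinM -!EFinD; congr EFin; ring.
Qed.

Lemma square_integrableZ c f : square_integrable f ->
  square_integrable (fun w => c * f w).
Proof.
move=> [mf if2]; split; first exact: measurable_funM.
have := integrableZl measurableT (c ^+ 2) if2.
by congr (_.-integrable _ _); apply/funext => w /=; rewrite -EFinM exprMn.
Qed.

Lemma square_integrable_norm f : square_integrable f ->
  square_integrable (fun w => `|f w|).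
Proof.
move=> [mf if2]; split; first exact: measurableT_comp.
by move: if2; congr (_.-integrable _ _); apply/funext => w /=;
  rewrite real_normK ?num_real.
Qed.

Lemma square_integrable_sum (I : Type) (s : seq I) (f : I -> T -> R) :
  (forall i, square_integrable (f i)) ->
  square_integrable (fun w => \sum_(i <- s) f i w).
Proof.
move=> sf; elim: s => [|i s IHs].
  by under eq_fun do rewrite big_nil; exact: square_integrable_cst.
by under eq_fun do rewrite big_cons; exact: square_integrableD.
Qed.

End square_integrable.

(** * Second moment of the standard Gaussian law *)

Section gaussian_moment.
Context {R : realType}.
Local Notation lambda := (@lebesgue_measure R).

(** The change of variables yields a Radon-Nikodym derivative, which agrees almost everywhere with
    [normal_pdf] because both have the same integrals over measurable sets. *)
Lemma ge0_integral_normal_prob (m s : R) (f : R -> \bar R) :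
  measurable_fun setT f -> (forall x, 0 <= f x)%E ->
  (\int[normal_prob m s]_x f x = \int[lambda]_x (f x * (normal_pdf m s x)%:E))%E.
Proof.
move=> mf f0; have dom := @normal_prob_dominates R m s.
rewrite -(Radon_Nikodym_SigmaFinite.change_of_variables dom) //=.
have iRN := Radon_Nikodym_SigmaFinite.f_integrable dom.
apply: ae_eq_integral => //.
- by apply: emeasurable_funM => //; exact: (measurable_int lambda).
- by apply: emeasurable_funM => //; apply/measurable_EFinP; exact: measurable_normal_pdf.
- apply: ae_eqe_mul2l; apply: integral_ae_eq => //.
    by apply/measurable_EFinP; exact: measurable_normal_pdf.
  by move=> A _ mA; rewrite -Radon_Nikodym_SigmaFinite.f_integral.
Qed.

(** Domination by a wider Gaussian density, of integral 1, shows that the second moment is finite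
    without computing it. The exponents differ by [3 / 8 * x ^+ 2], whose exponential beats
    [x ^+ 2 / 4]; the other factor 2 in 8 is the ratio of the peaks. *)
Lemma sqr_normal_pdf_le (x : R) :
  x ^+ 2 * normal_pdf 0 1 x <= 8 * normal_pdf 0 2 x.
Proof.
have n1 : (1 : R) != 0 by rewrite oner_neq0.
have n2 : (2 : R) != 0 by rewrite pnatr_eq0.
rewrite !normal_pdfE // /normal_peak /normal_fun !subr0.
have -> : Num.sqrt ((2 : R) ^+ 2 * pi *+ 2) = 2 * Num.sqrt (1 ^+ 2 * pi *+ 2).
  rewrite (_ : 2 ^+ 2 * pi *+ 2 = 2 ^+ 2 * (1 ^+ 2 * pi *+ 2)); last by ring.
  by rewrite sqrtrM ?sqr_ge0 // sqrtr_sqr ger0_norm.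
set p := Num.sqrt _.
have p0 : 0 <= p^-1 by rewrite invr_ge0 sqrtr_ge0.
rewrite (_ : - x ^+ 2 / (1 ^+ 2 *+ 2) =
  - x ^+ 2 / (2 ^+ 2 *+ 2) - 3 / 8 * x ^+ 2); last by field.
rewrite expRD invfM; set e := expR (- x ^+ 2 / _).
have e0 : 0 <= e by exact: expR_ge0.
have : x ^+ 2 * expR (- (3 / 8 * x ^+ 2)) <= 4.
  rewrite expRN ler_pdivrMr ?expR_gt0 //.
  have := expR_ge1Dx (3 / 8 * x ^+ 2); have := sqr_ge0 x.
  by move: (x ^+ 2) => u; lra.
move=> /(ler_wpM2l (mulr_ge0 p0 e0)) bound.
rewrite (_ : x ^+ 2 * _ = p^-1 * e * (x ^+ 2 * expR (- (3 / 8 * x ^+ 2)))); last first.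
  by ring.
apply: (le_trans bound); rewrite (_ : 8 * _ = p^-1 * e * 4) //.
by move: (p^-1) => q; field.
Qed.

Lemma standard_gaussian_square_integrable d (T : measurableType d)
    (Pr : probability T R) (X : {RV Pr >-> R}) :
  standard_gaussian X -> square_integrable Pr X.
Proof.
move=> gX; split; first exact: measurable_funPT.
apply/integrableP; split.
  by apply/measurable_EFinP; apply: measurable_funX; exact: measurable_funPT.
(* [normal_prob] lives on [measurableTypeR R], which has the sigma-algebra of [R]
   under another display. *)
have mX : measurable_fun setT (X : T -> measurableTypeR R) by exact: (measurable_funPT X).
pose XR : {mfun T >-> measurableTypeR R} :=
  HB.pack (X : T -> measurableTypeR R) (isMeasurableFun.Build _ _ _ _ _ mX).
pose f (x : measurableTypeR R) := ((x : R) ^+ 2)%:E.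
have mf : measurable_fun setT f by apply/measurable_EFinP; exact: measurable_funX.
rewrite (eq_integral (f \o XR)); last first.
  by move=> w _ /=; rewrite ger0_norm // sqr_ge0.
have f0 x : (0 <= f x)%E by rewrite lee_fin sqr_ge0.
rewrite -ge0_integral_distribution //.
rewrite (@eq_measure_integral _ _ _ setT [the measure _ _ of normal_prob 0 1]); last first.
  by move=> A mA _; exact: gX.
rewrite ge0_integral_normal_prob //.
apply: (@le_lt_trans _ _ (\int[lambda]_x (8 * normal_pdf 0 2 x)%:E)%E).
  apply: ge0_le_integral => //.
  - by move=> x _; rewrite mule_ge0 // lee_fin normal_pdf_ge0.
  - by apply: emeasurable_funM => //; apply/measurable_EFinP; exact: measurable_normal_pdf.
  - by apply/measurable_EFinP; apply: measurable_funM => //; exact: measurable_normal_pdf.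
  - by move=> x _; rewrite -EFinM lee_fin sqr_normal_pdf_le.
under eq_integral do rewrite EFinM.
rewrite ge0_integralZl //=.
- by rewrite integral_normal_pdf mule1 ltry.
- by apply/measurable_EFinP; exact: measurable_normal_pdf.
- by move=> x _; rewrite lee_fin normal_pdf_ge0.
Qed.

End gaussian_moment.

(** * Independent blocks *)

Section boxes.
Context {I : finType} {R : realType}.

Definition box (B : I -> set R) : set (I -> R) := [set x | forall i, B i (x i)].

Definition boxes : set (set (I -> R)) :=
  [set box B | B in [set B | forall i, measurable (B i)]].

(** The product sigma-algebra. Its generating boxes are closed under intersection, so finite
    measures of equal total mass that agree on boxes are equal. *)
Definition blockType := g_sigma_algebraType boxes.

Lemma boxesT : boxes setT.
Proof.
exists (fun=> setT) => [i|]; first exact: measurableT.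
by apply/seteqP; split.
Qed.

Lemma boxesI : setI_closed boxes.
Proof.
move=> _ _ [A mA <-] [B mB <-]; exists (fun i => A i `&` B i).
  by move=> i; exact: measurableI.
apply/seteqP; split => x /= => [xAB|[xA xB] i]; last by split.
by split=> i; have [] := xAB i.
Qed.

Lemma measurable_coordinate (i : I) : measurable_fun setT (fun x : blockType => x i).
Proof.
move=> _ B mB; rewrite setTI; apply: sub_sigma_algebra.
exists (fun j => if j == i then B else setT).
  by move=> j; case: eqP => _ //; exact: measurableT.
apply/seteqP; split => x /=; first by move=> /(_ i); rewrite eqxx.
by move=> Bxi j; case: eqP => // ->.
Qed.

Context d (T : measurableType d).

Lemma measurable_block (X : I -> T -> R) : (forall i, measurable_fun setT (X i)) ->
  measurable_fun setT (fun w => X ^~ w : blockType).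
Proof.
move=> mX; apply: (@measurability _ _ T blockType setT _ boxes) => //.
move=> _ [_ [B mB <-] <-]; rewrite setTI.
rewrite (_ : _ @^-1` _ = \bigcap_(i in setT) (X i @^-1` B i)).
  apply: fin_bigcap_measurable => // i _.
  by rewrite -[X in measurable X]setTI; exact: mX.
by apply/seteqP; split => w /= wB i; [move=> _; exact: wB|exact: wB].
Qed.

Lemma measure_unique_boxes (m1 m2 : {measure set blockType -> \bar R}) :
  (m1 setT < +oo)%E ->
  (forall B, (forall i, measurable (B i)) -> m1 (box B) = m2 (box B)) ->
  forall A, measurable A -> m1 A = m2 A.
Proof.
move=> m1oo m12; apply: (@measure_unique _ R blockType boxes (fun=> setT)) => //.
- exact: boxesI.
- by move=> _; exact: boxesT.
- by rewrite bigcup_const.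
- by move=> _ [B mB <-]; exact: m12.
Qed.

End boxes.
Arguments blockType : clear implicits.

Section block_laws.
Context {I : finType} {R : realType}.
Context d (T : measurableType d) (Pr : probability T R).
Variables (X Y : {mfun T >-> blockType I R}).

Let joint (w : T) : blockType I R * blockType I R := (X w, Y w).

Section identical.
Hypothesis XY_boxes : forall B : I -> set R, (forall i, measurable (B i)) ->
  Pr (X @^-1` box B) = Pr (Y @^-1` box B).

Lemma identical_blocks_expectation (f : blockType I R -> R) :
  measurable_fun setT f -> Pr.-integrable setT (EFin \o (f \o X)) ->
  Pr.-integrable setT (EFin \o (f \o Y)) ->
  \int[Pr]_w f (X w) = \int[Pr]_w f (Y w).
Proof.
move=> mf fX fY; have mEf : measurable_fun setT (EFin \o f) by exact/measurable_EFinP.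
rewrite /Rintegral -(integral_distribution mEf fX) -(integral_distribution mEf fY).
congr fine; apply: eq_measure_integral => A mA _.
apply: measure_unique_boxes mA => [|B mB]; last exact: XY_boxes.
by rewrite /= /distribution /pushforward preimage_setT probability_setT ltry.
Qed.

End identical.

Section independent.
Hypothesis XY_boxes : forall A B : I -> set R,
  (forall i, measurable (A i)) -> (forall i, measurable (B i)) ->
  Pr (X @^-1` box A `&` Y @^-1` box B) =
  (Pr (X @^-1` box A) * Pr (Y @^-1` box B))%E.

(** For fixed [E] both sides are finite measures in [A]: a restriction to [E] and a multiple by
    [Pr E]. Agreement on boxes therefore suffices; [independent_blocks] uses this once for each
    variable. *)
Let independent_extend (Z : {mfun T >-> blockType I R}) (E : set T) : measurable E ->
  (forall B, (forall i, measurable (B i)) ->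
    Pr (Z @^-1` box B `&` E) = (Pr (Z @^-1` box B) * Pr E)%E) ->
  forall A, measurable A -> Pr (Z @^-1` A `&` E) = (Pr (Z @^-1` A) * Pr E)%E.
Proof.
move=> mE ZE A mA; pose p := NngNum (fine_ge0 (measure_ge0 Pr E)).
have pE : p%:num%:E = Pr E by rewrite fineK // fin_num_measure.
pose PE : {measure set T -> \bar R} := mrestr Pr mE.
pose m1' : {measure set (blockType I R) -> \bar R} := pushforward PE Z.
pose m1 := m1' (measurable_funPT Z).
pose PZ : {measure set (blockType I R) -> \bar R} := distribution Pr Z.
pose m2 : {measure set (blockType I R) -> \bar R} := mscale p PZ.
have m1E B : m1 B = Pr (Z @^-1` B `&` E) by [].
have m2E B : m2 B = (Pr (Z @^-1` B) * Pr E)%E by rewrite muleC -pE.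
rewrite -m1E -m2E; apply: measure_unique_boxes mA => [|B mB].
  by rewrite m1E preimage_setT setTI (le_lt_trans (probability_le1 _ _)) ?ltry.
by rewrite m1E m2E ZE.
Qed.

Lemma independent_blocks A B : measurable A -> measurable B ->
  Pr (X @^-1` A `&` Y @^-1` B) = (Pr (X @^-1` A) * Pr (Y @^-1` B))%E.
Proof.
move=> mA mB; apply: independent_extend => //; first exact: measurable_funPTI.
move=> A' mA'; rewrite setIC muleC; apply: independent_extend => //.
  by apply: measurable_funPTI; apply: sub_sigma_algebra; exists A'.
by move=> B' mB'; rewrite setIC muleC; exact: XY_boxes.
Qed.

Lemma independent_blocks_expectation (f g : blockType I R -> R) :
  measurable_fun setT f -> measurable_fun setT g ->
  square_integrable Pr (f \o X) -> square_integrable Pr (g \o Y) ->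
  \int[Pr]_w (f (X w) * g (Y w)) = (\int[Pr]_w f (X w)) * (\int[Pr]_w g (Y w)).
Proof.
move=> mf mg fX gY; have [[mfX _] [mgY _]] := (fX, gY).
have ifX := square_integrable_integrable fX; have igY := square_integrable_integrable gY.
have ifg := integrable_mul_square fX gY.
have mJ : measurable_fun setT joint by apply: measurable_fun_pair; exact: measurable_funPT.
pose J : {mfun T >-> (blockType I R * blockType I R)%type} :=
  HB.pack joint (isMeasurableFun.Build _ _ _ _ _ mJ).
pose PX := distribution Pr X; pose PY := distribution Pr Y.
pose fg (z : blockType I R * blockType I R) := (f z.1 * g z.2)%:E.
have mfg : measurable_fun setT fg.
  by apply/measurable_EFinP; apply: measurable_funM; apply: measurableT_comp.
(* Independence says that the joint law is the product law, which opens the way to Fubini's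
   theorem. *)
have law A : measurable A -> (PX \x PY)%E A = distribution Pr J A.
  apply: product_measure_unique => B C mB mC; exact: independent_blocks.
have int_joint : (\int[Pr]_w fg (J w) = \int[PX \x PY]_z fg z)%E.
  rewrite -(integral_distribution mfg) //.
  by apply: eq_measure_integral => A mA _; exact/esym/law.
have ifg' : (PX \x PY)%E.-integrable setT fg.
  have /integrableP[_] := integrable_pushforward mJ mfg ifg measurableT.
  move=> fin; apply/integrableP; split=> //; apply: le_lt_trans fin.
  rewrite le_eqVlt; apply/orP; left; apply/eqP.
  by apply: (@eq_measure_integral _ _ _ setT (distribution Pr J)) => A mA _; exact: law.
have mEf : measurable_fun setT (EFin \o f) by exact/measurable_EFinP.
have mEg : measurable_fun setT (EFin \o g) by exact/measurable_EFinP.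
rewrite /Rintegral (_ : (\int[Pr]_w _)%E = \int[Pr]_w fg (J w))%E // int_joint.
rewrite -(integral12_prod_meas1 ifg') /fubini_F.
rewrite (@eq_integral _ _ _ PX setT (fun x => (f x)%:E * (\int[Pr]_w g (Y w))%:E)%E); last first.
  move=> x _; rewrite fineK; last exact: (integrable_fin_num measurableT igY).
  rewrite -(integral_distribution mEg igY) -integralZl //.
  exact: (integrable_pushforward _ mEg igY).
rewrite integralZr //; last exact: (integrable_pushforward _ mEf ifX).
by rewrite (integral_distribution mEf ifX) fineM // (integrable_fin_num measurableT ifX).
Qed.
End independent.
End block_laws.

Lemma mutually_independent_inj d (T : measurableType d) (R : realType)
    (Pr : probability T R) (I : finType) (K : eqType) (J : set K)
    (Z : K -> {RV Pr >-> R}) (e : I -> K) (B : I -> set R) :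
  mutually_independent J Z -> injective e -> (forall i, J (e i)) ->
  (forall i, measurable (B i)) ->
  Pr [set w | forall i, B i (Z (e i) w)] = (\prod_i Pr (Z (e i) @^-1` B i))%E.
Proof.
move=> indep e_inj eJ mB.
(* [mutually_independent] asks for sets indexed by all of [K]: off the image of [e] take the whole
   line. *)
pose B' k := if [pick i | e i == k] is Some i then B i else setT.
have B'e i : B' (e i) = B i.
  rewrite /B'; case: pickP => [j /eqP/e_inj -> //|/(_ i)]; by rewrite eqxx.
have mB' k : measurable (B' k) by rewrite /B'; case: pickP.
have sub : [set` map e (enum I)] `<=` J.
  by move=> _ /= /mapP[i _ ->].
have := indep (map e (enum I)) B' _ sub mB'.
rewrite map_inj_uniq // enum_uniq => /(_ isT).
rewrite big_map big_enum /=.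
under eq_bigr do rewrite B'e.
move=> <-; congr (Pr _); apply/seteqP; split => w /=.
  by move=> wB _ /mapP[i _ ->] /=; rewrite B'e; exact: wB.
move=> wB i; rewrite -B'e; apply: (wB (e i)) => /=.
by apply/mapP; exists i; rewrite ?mem_enum.
Qed.

(** * Stationarity and independence of blocks of observations *)

Section observation_blocks.
Context {R : realType} {M : nat} (n : nat).
Local Notation idx := ('I_M * 'I_n.+1)%type.

(** Times from [n.+1] on are sent by [inord] to a default index; functionals satisfying
    [depends_before] do not see them. *)
Definition block_obs (x : blockType idx R) (m : 'I_M) (j : nat) : R := x (m, inord j).

Lemma measurable_block_obs m j : measurable_fun setT (fun x => block_obs x m j).
Proof. exact: measurable_coordinate. Qed.

Definition depends_before (F : ('I_M -> nat -> R) -> R) :=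
  forall y y' : 'I_M -> nat -> R,
    (forall m j, (j < n.+1)%N -> y m j = y' m j) -> F y = F y'.

Context d (T : measurableType d) (Pr : probability T R).
Variable y : 'I_M -> nat -> {RV Pr >-> R}.

(** The observations after time [a], renumbered from 0; the successor returns to times starting at
    1, where [y] is Gaussian and independent. *)
Definition obs (a : nat) (w : T) (m : 'I_M) (j : nat) : R := y m (a + j).+1 w.

Let block a (w : T) : blockType idx R := fun i => obs a w i.1 i.2.

Let mblock a : measurable_fun setT (block a).
Proof. by apply: measurable_block => i; exact: measurable_funPT. Qed.

Let Block a : {mfun T >-> blockType idx R} :=
  HB.pack (block a) (isMeasurableFun.Build _ _ _ _ _ (mblock a)).

Lemma block_obsE F : depends_before F -> forall a w, F (block_obs (block a w)) = F (obs a w).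
Proof. by move=> locF a w; apply: locF => m j jn; rewrite /block_obs /block /= inordK. Qed.

Hypothesis y_independent : mutually_independent
  [set mn : 'I_M * nat | (1 <= mn.2)%N] (fun mn => y mn.1 mn.2).
Hypothesis y_gaussian : forall (m : 'I_M) (k : nat),
  (1 <= k)%N -> standard_gaussian (y m k).

Let block_law a (B : idx -> set R) : (forall i, measurable (B i)) ->
  Pr (Block a @^-1` box B) = (\prod_i normal_prob 0 1 (B i))%E.
Proof.
move=> mB; pose e (i : idx) := (i.1, (a + i.2).+1).
have e_inj : injective e.
  by move=> [m i] [m' i'] [-> /addnI/val_inj ->].
have := mutually_independent_inj (e := e) (B := B) y_independent e_inj (fun=> erefl) mB.
rewrite [LHS](_ : _ = Pr (Block a @^-1` box B)) // => ->.
by apply: eq_bigr => i _; rewrite -(@y_gaussian i.1 (a + i.2).+1 erefl).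
Qed.

(** The two blocks use disjoint times, so a single injection from the sum of their index types
    reduces the claim to mutual independence. *)
Let blocks_law (A B : idx -> set R) :
  (forall i, measurable (A i)) -> (forall i, measurable (B i)) ->
  Pr (Block 0 @^-1` box A `&` Block n.+1 @^-1` box B) =
  (Pr (Block 0 @^-1` box A) * Pr (Block n.+1 @^-1` box B))%E.
Proof.
move=> mA mB.
pose e (s : idx + idx) := match s with
  | inl i => (i.1, (0 + i.2).+1) | inr i => (i.1, (n.+1 + i.2).+1) end.
pose C (s : idx + idx) := match s with inl i => A i | inr i => B i end.
have mC s : measurable (C s) by case: s.
have e_inj : injective e.
  move=> [[m i]|[m i]] [[m' i']|[m' i']] [-> ] //.
  - by move=> /val_inj ->.
  - by have := ltn_ord i; lia.
  - by have := ltn_ord i'; lia.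
  - by move=> /addnI/val_inj ->.
have eJ s : (1 <= (e s).2)%N by case: s.
have := mutually_independent_inj (e := e) (B := C) y_independent e_inj eJ mC.
rewrite big_sumType /= => ind; rewrite !block_law //.
rewrite [LHS](_ : _ = Pr [set w | forall s, C s (y (e s).1 (e s).2 w)]).
  rewrite ind; congr (_ * _)%E; apply: eq_bigr => i _.
    by rewrite -(@y_gaussian i.1 (0 + i.2).+1 erefl).
  by rewrite -(@y_gaussian i.1 (n.+1 + i.2).+1 erefl).
congr (Pr _); apply/seteqP; split => w /=.
  by move=> [wA wB] [i|i]; [exact: wA|exact: wB].
by move=> wC; split => i; [exact: (wC (inl i))|exact: (wC (inr i))].
Qed.

Section functional.
Variables F G : ('I_M -> nat -> R) -> R.
Hypothesis F_local : depends_before F.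
Hypothesis G_local : depends_before G.
Hypothesis mF : measurable_fun setT (fun x : blockType idx R => F (block_obs x)).
Hypothesis mG : measurable_fun setT (fun x : blockType idx R => G (block_obs x)).

Lemma stationary_expectation a :
  Pr.-integrable setT (EFin \o (fun w => F (obs 0 w))) ->
  Pr.-integrable setT (EFin \o (fun w => F (obs a w))) ->
  \int[Pr]_w F (obs a w) = \int[Pr]_w F (obs 0 w).
Proof.
move=> i0 ia.
have FE b : (fun w => F (obs b w)) = (fun x => F (block_obs x)) \o Block b.
  by apply/funext => w /=; rewrite block_obsE.
rewrite !FE in i0 ia *; apply: identical_blocks_expectation => //.
by move=> B mB; rewrite !block_law.
Qed.

Lemma independent_expectation :
  square_integrable Pr (fun w => F (obs 0 w)) ->
  square_integrable Pr (fun w => G (obs n.+1 w)) ->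
  \int[Pr]_w (F (obs 0 w) * G (obs n.+1 w)) =
  (\int[Pr]_w F (obs 0 w)) * (\int[Pr]_w G (obs n.+1 w)).
Proof.
move=> i0 ia.
have FE b : (fun w => F (obs b w)) = (fun x => F (block_obs x)) \o Block b.
  by apply/funext => w /=; rewrite block_obsE.
have GE b : (fun w => G (obs b w)) = (fun x => G (block_obs x)) \o Block b.
  by apply/funext => w /=; rewrite block_obsE.
have -> : (fun w => F (obs 0 w) * G (obs n.+1 w)) =
  (fun w => F (block_obs (Block 0 w)) * G (block_obs (Block n.+1 w))).
  by apply/funext => w /=; rewrite !block_obsE.
rewrite FE GE in i0 ia *.
exact: (independent_blocks_expectation blocks_law mF mG).
Qed.

End functional.
End observation_blocks.

(** * Second moments of sums *)

Lemma sqr_sum_le {R : realType} k (x : nat -> R) :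
  (\sum_(j < k) x j) ^+ 2 <= k%:R * \sum_(j < k) x j ^+ 2.
Proof.
elim: k => [|[|k] IHk]; first by rewrite !big_ord0 expr0n mul0r.
  by rewrite !big_ord_recr !big_ord0 /= !add0r mul1r.
rewrite big_ord_recr [X in _ * X]big_ord_recr /=; move: IHk.
move: (\sum_(j < _) _) => S; move: (\sum_(j < _) _) (x k.+1) => Q a SQ.
rewrite -[k.+2%:R]natr1; have : 0 < k.+1%:R :> R by rewrite ltr0n.
move: k.+1%:R SQ => c SQ c0.
(* This square, with [c] the number of terms in [S], is the slack gained when the term [a] is
   added. *)
have : 0 <= c^-1 * (S - c * a) ^+ 2 by rewrite mulr_ge0 ?sqr_ge0 ?invr_ge0 ?(ltW c0).
have : c^-1 * S ^+ 2 <= Q by rewrite ler_pdivrMl.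
rewrite (_ : c^-1 * (S - c * a) ^+ 2 = c^-1 * S ^+ 2 - 2 * S * a + c * a ^+ 2); last first.
  by field; rewrite gt_eqF.
nra.
Qed.

Section sums.
Context d (T : measurableType d) (R : realType) (Pr : probability T R).

Lemma integrable_real_sum (I : Type) (s : seq I) (f : I -> T -> R) :
  (forall i, Pr.-integrable setT (EFin \o f i)) ->
  Pr.-integrable setT (EFin \o (fun w => \sum_(i <- s) f i w)).
Proof.
move=> fint; elim: s => [|i s IHs].
  under eq_fun do rewrite big_nil.
  exact: (@finite_measure_integrable_cst _ _ _ Pr setT 0 measurableT).
have := integrableD measurableT (fint i) IHs.
by congr (_.-integrable _ _); apply/funext => w /=; rewrite big_cons EFinD.
Qed.

Lemma integrable_realZ c (f : T -> R) : Pr.-integrable setT (EFin \o f) ->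
  Pr.-integrable setT (EFin \o (fun w => c * f w)).
Proof.
by move=> /(integrableZl measurableT c); congr (_.-integrable _ _); apply/funext.
Qed.

Lemma Rintegral_sum (I : Type) (s : seq I) (f : I -> T -> R) :
  (forall i, Pr.-integrable setT (EFin \o f i)) ->
  \int[Pr]_w (\sum_(i <- s) f i w) = \sum_(i <- s) \int[Pr]_w f i w.
Proof.
move=> fint.
elim: s => [|i s IHs].
  under eq_Rintegral do rewrite big_nil.
  by rewrite big_nil Rintegral_cst // mul0r.
under eq_Rintegral do rewrite big_cons.
by rewrite big_cons RintegralD ?IHs //; exact: integrable_real_sum.
Qed.

(** The crude factor [k ^ 2] is affordable in both uses: for the fixed number [r] of terms of a
    defect, and for gaps of order [j ^ 3] measured against [j ^ 4]. *)
Lemma sqr_sum_expectation_le k (f : nat -> T -> R) (eta : R) :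
  (forall j, square_integrable Pr (f j)) ->
  (forall j, \int[Pr]_w (f j w ^+ 2) <= eta) ->
  \int[Pr]_w ((\sum_(j < k) f j w) ^+ 2) <= k%:R ^+ 2 * eta.
Proof.
move=> sf feta.
have sS := square_integrable_sum (index_enum 'I_k)
  (f := fun j => f (nat_of_ord j)) (fun j => sf j).
have iQ : Pr.-integrable setT (EFin \o (fun w => \sum_(j < k) f j w ^+ 2)).
  by apply: integrable_real_sum => j; exact: (sf j).2.
apply: (@le_trans _ _ (\int[Pr]_w (k%:R * \sum_(j < k) f j w ^+ 2))).
  apply: le_Rintegral => //; [exact: sS.2|exact: integrable_realZ|].
  by move=> w _; exact: (sqr_sum_le k (f ^~ w)).
rewrite RintegralZl //.
rewrite Rintegral_sum; last by move=> j; exact: (sf j).2.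
rewrite expr2 -mulrA ler_wpM2l //.
apply: (@le_trans _ _ (\sum_(j < k) eta)); first by apply: ler_sum => j _; exact: feta.
by rewrite sumr_const card_ord mulr_natl.
Qed.

End sums.

(** * Locality and measurability of the log likelihood *)

Section likelihood_regularity.
Context {R : realType} {M : nat}.
Variables (P : 'M[R]_M) (mu : 'cV[R]_M) (beta : R).

Lemma log_likelihood_local N (y y' : 'I_M -> nat -> R) :
  (forall m j, (j < N)%N -> y m j = y' m j) ->
  log_likelihood P mu beta y N = log_likelihood P mu beta y' N.
Proof.
move=> yy'; rewrite /log_likelihood; congr (ln (mass _)).
elim: N yy' => // N IHN yy'; apply/rowP => m; rewrite !forwardS IHN.
  by rewrite /obs_weight yy'.
by move=> m' j jN; apply: yy'; rewrite ltnW.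
Qed.

Context d (S : measurableType d) (Y : 'I_M -> nat -> S -> R).
Hypothesis mY : forall m j, measurable_fun setT (Y m j).

Lemma measurable_obs_size j :
  measurable_fun setT (fun w => obs_size beta (fun m j => Y m j w) j).
Proof.
apply: measurable_funD => //; apply: measurable_funM => //.
by apply: measurable_sum => m; apply: measurableT_comp.
Qed.

Lemma measurable_log_likelihood N :
  measurable_fun setT (fun w => log_likelihood P mu beta (fun m j => Y m j w) N).
Proof.
have mfwd m : measurable_fun setT
    (fun w => forward P (obs_weight beta (fun m j => Y m j w)) mu^T N 0 m).
  elim: N m => [|N IHN] m; first exact: measurable_cst.
  under eq_fun do rewrite forwardS mxE.
  apply: measurable_funM.
    by apply: measurable_sum => i; apply: measurable_funM.
  apply: measurable_funM => //; apply: measurableT_comp => //.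
  exact: measurable_funM.
by apply: measurableT_comp => //; apply: measurable_sum.
Qed.

End likelihood_regularity.

(** Let [(j.+1 ^ 4)] be the last fourth power up to [N]: then [z N] is within [s j] of its value
    there, and dividing by [N] helps more than dividing by that power. Squares appear because second
    moments control them. *)
Lemma subsequence_cvg0 {R : realType} (z s : nat -> R) :
  (forall j N, (j.+1 ^ 4 <= N)%N -> (N < j.+2 ^ 4)%N ->
    `|z N - z (j.+1 ^ 4)%N| <= s j) ->
  (z (j.+1 ^ 4)%N / (j.+1 ^ 4)%:R) ^+ 2 @[j --> \oo] --> (0 : R) ->
  (s j / (j.+1 ^ 4)%:R) ^+ 2 @[j --> \oo] --> (0 : R) ->
  N%:R^-1 * z N @[N --> \oo] --> (0 : R).
Proof.
move=> zs /cvgr0Pnorm_lt z0 /cvgr0Pnorm_lt s0.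
apply/cvgr0Pnorm_le => e e0.
have e2 : 0 < (e / 2) ^+ 2 by rewrite exprn_gt0 // divr_gt0.
have [J1 _ zJ] := z0 _ e2; have [J2 _ sJ] := s0 _ e2.
have sqr_lt (x D : R) : 0 < D -> `|(x / D) ^+ 2| < (e / 2) ^+ 2 -> `|x| <= e / 2 * D.
  move=> D0; rewrite normrX ltr_sqr ?nnegrE ?divr_ge0 ?(ltW e0) //.
  by rewrite normrM normfV (gtr0_norm D0) ltr_pdivrMr // => /ltW.
pose J := maxn J1 J2; exists (J.+1 ^ 4)%N => // N JN.
have ex : exists j, (j.+1 ^ 4 <= N)%N by exists J.
have bd j : (j.+1 ^ 4 <= N)%N -> (j <= N)%N.
  by apply: leq_trans; apply: ltnW; rewrite -[X in (X <= _)%N]expn1 leq_pexp2l.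
case: (ex_maxnP ex bd) => j jN jmax.
have Jj : (J <= j)%N by apply: jmax.
have Nj : (N < j.+2 ^ 4)%N by rewrite ltnNge; apply/negP => /jmax; rewrite ltnn.
have D0 : 0 < (j.+1 ^ 4)%:R :> R by rewrite ltr0n expn_gt0.
have zj := sqr_lt _ _ D0 (zJ j (leq_trans (leq_maxl _ _) Jj)).
have sj := sqr_lt _ _ D0 (sJ j (leq_trans (leq_maxr _ _) Jj)).
have N0 : 0 < N%:R :> R by rewrite (lt_le_trans D0) // ler_nat.
rewrite normrM normfV (gtr0_norm N0) ler_pdivrMl //.
have DN : e * (j.+1 ^ 4)%:R <= e * N%:R by rewrite ler_wpM2l ?ler_nat // ltW.
have := ler_normD (z N - z (j.+1 ^ 4)%N) (z (j.+1 ^ 4)%N); rewrite subrK.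
have := zs j N jN Nj; have := ler_norm (s j).
by move: DN zj sj; rewrite [N%:R * e]mulrC; lra.
Qed.

(** * The rate *)

Section rate.
Context {R : realType} {M : nat}.
Variables (P : 'M[R]_M) (mu : 'cV[R]_M) (beta : R).
Context d (T : measurableType d) (Pr : probability T R).
Variable y : 'I_M -> nat -> {RV Pr >-> R}.
Hypothesis P_stochastic : stochastic_matrix P.
Hypothesis mu_stationary : stationary_distribution P mu.
Hypothesis beta_gt0 : 0 < beta.
Hypothesis y_independent : mutually_independent
  [set mn : 'I_M * nat | (1 <= mn.2)%N] (fun mn => y mn.1 mn.2).
Hypothesis y_gaussian : forall (m : 'I_M) (k : nat),
  (1 <= k)%N -> standard_gaussian (y m k).
Variables (r : nat) (delta : R).
Hypothesis delta_gt0 : 0 < delta.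
Hypothesis delta_le1 : delta <= 1.
Hypothesis P_primitive : forall i j, delta <= (P ^+ r) i j.

Let ell a N (w : T) : R := log_likelihood P mu beta (obs y a w) N.
Let size_at a (w : T) : R := obs_size beta (obs y a w) 0.

Let obs_size_at a j w : obs_size beta (obs y a w) j = size_at (a + j) w.
Proof. by rewrite /size_at /obs_size /obs addn0. Qed.

Let defect n w := 2 * (\sum_(j < r) size_at (n + j) w) - ln delta.

Let ell_almost_additive n k w :
  `|ell 0 (n + k) w - ell 0 n w - ell n k w| <= defect n w.
Proof.
have := log_likelihood_almost_additive P_stochastic mu_stationary beta_gt0
  (obs y 0 w) n k delta_gt0 delta_le1 P_primitive.
by rewrite /defect; under eq_bigr do rewrite obs_size_at add0n.
Qed.

Let ell_increment n k w :
  `|ell 0 (n + k) w - ell 0 n w| <= \sum_(j < k) size_at (n + j) w.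
Proof.
have := log_likelihood_increment P_stochastic mu_stationary beta_gt0 (obs y 0 w) n k.
by under eq_bigr do rewrite obs_size_at add0n.
Qed.

Let ell_bound a N w : `|ell a N w| <= \sum_(j < N) size_at (a + j) w.
Proof.
have := norm_log_likelihood P_stochastic mu_stationary beta_gt0 (obs y a w) N.
by under eq_bigr do rewrite obs_size_at.
Qed.

Let size_at_ge0 a w : 0 <= size_at a w.
Proof. exact: obs_size_ge0. Qed.

Let measurable_obs a m j : measurable_fun setT (fun w => obs y a w m j).
Proof. exact: measurable_funPT. Qed.

Let size_at_sq a : square_integrable Pr (size_at a).
Proof.
apply: square_integrableD; first exact: square_integrable_cst.
apply: square_integrableZ; apply: square_integrable_sum => m.
apply: square_integrable_norm; apply: standard_gaussian_square_integrable.
exact: y_gaussian.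
Qed.

Let ell_measurable a N : measurable_fun setT (ell a N).
Proof. exact: measurable_log_likelihood. Qed.

Let ell_sq a N : square_integrable Pr (ell a N).
Proof.
apply: square_integrable_le (ell_bound a N) => //.
exact: square_integrable_sum.
Qed.

Let defect_sq n : square_integrable Pr (defect n).
Proof.
apply: square_integrableD; last exact: square_integrable_cst.
apply: square_integrableZ; exact: square_integrable_sum.
Qed.

(** A general [f] covers both the mean and the centred second moment. *)
Let ell_shift_expectation (f : R -> R) a N : (0 < N)%N -> measurable_fun setT f ->
  Pr.-integrable setT (EFin \o (fun w => f (ell 0 N w))) ->
  Pr.-integrable setT (EFin \o (fun w => f (ell a N w))) ->
  \int[Pr]_w f (ell a N w) = \int[Pr]_w f (ell 0 N w).
Proof.
case: N => [N0|n _ mf i0 ia]; first by discriminate N0.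
pose F z := f (log_likelihood P mu beta z n.+1).
have F_local : depends_before (M := M) n F.
  by move=> z z' zz'; congr f; exact: log_likelihood_local.
have mF : measurable_fun setT (fun x : blockType ('I_M * 'I_n.+1)%type R => F (block_obs x)).
  apply: (measurableT_comp mf); apply: measurable_log_likelihood.
  by move=> m j; exact: measurable_block_obs.
exact: (stationary_expectation y_independent y_gaussian F_local mF i0 ia).
Qed.

Let size_shift_expectation (f : R -> R) a : measurable_fun setT f ->
  Pr.-integrable setT (EFin \o (fun w => f (size_at 0 w))) ->
  Pr.-integrable setT (EFin \o (fun w => f (size_at a w))) ->
  \int[Pr]_w f (size_at a w) = \int[Pr]_w f (size_at 0 w).
Proof.
move=> mf i0 ia; pose F (z : 'I_M -> nat -> R) := f (obs_size beta z 0).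
have F_local : depends_before (M := M) 0 F.
  move=> z z' zz'; congr f; rewrite /obs_size; congr (_ + _ * _).
  by apply: eq_bigr => m _; rewrite zz'.
have mF : measurable_fun setT (fun x : blockType ('I_M * 'I_1)%type R => F (block_obs x)).
  apply: (measurableT_comp mf); apply: measurable_obs_size.
  by move=> m j; exact: measurable_block_obs.
exact: (stationary_expectation y_independent y_gaussian F_local mF i0 ia).
Qed.

Let E (f : T -> R) : R := \int[Pr]_w f w.

Let ED f g : square_integrable Pr f -> square_integrable Pr g ->
  E (fun w => f w + g w) = E f + E g.
Proof.
move=> sf sg; rewrite /E RintegralD //; exact: square_integrable_integrable.
Qed.

Let intD f g : Pr.-integrable setT (EFin \o f) -> Pr.-integrable setT (EFin \o g) ->
  Pr.-integrable setT (EFin \o (fun w => f w + g w)).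
Proof.
by move=> /(integrableD measurableT)/[apply]; congr (_.-integrable _ _); apply/funext.
Qed.

Let EDi f g : Pr.-integrable setT (EFin \o f) -> Pr.-integrable setT (EFin \o g) ->
  E (fun w => f w + g w) = E f + E g.
Proof. by move=> sf sg; rewrite /E RintegralD. Qed.

Let EZi c f : Pr.-integrable setT (EFin \o f) -> E (fun w => c * f w) = c * E f.
Proof. by move=> sf; rewrite /E RintegralZl. Qed.

Let E_cst c : E (fun=> c) = c.
Proof. by rewrite /E Rintegral_cst //= probability_setT /= mulr1. Qed.

Let le_E f g : Pr.-integrable setT (EFin \o f) -> Pr.-integrable setT (EFin \o g) ->
  (forall w, f w <= g w) -> E f <= E g.
Proof. by move=> sf sg fg; apply: le_Rintegral. Qed.

Let E_ell_shift a N : E (ell a N) = E (ell 0 N).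
Proof.
have [->|N0] := posnP N.
  have ell0 b : ell b 0 = cst 0 by apply/funext => w; exact: log_likelihood0.
  by rewrite !ell0.
by apply: (@ell_shift_expectation id) => //; exact: square_integrable_integrable.
Qed.

Let g := E (defect 0).

Let E_defect n : E (defect n) = g.
Proof.
have Edef a : E (defect a) = r%:R * (2 * E (size_at 0)) - ln delta.
  have sS : square_integrable Pr (fun w => 2 * \sum_(j < r) size_at (a + j) w).
    by apply: square_integrableZ; exact: square_integrable_sum.
  rewrite /defect (ED sS (square_integrable_cst Pr _)) E_cst; congr (_ - _).
  rewrite /E RintegralZl //; last first.
    by apply: square_integrable_integrable; exact: square_integrable_sum.
  rewrite Rintegral_sum; last by move=> j; exact: square_integrable_integrable.
  under eq_bigr => j _.
    rewrite (@size_shift_expectation id) //; try exact: square_integrable_integrable.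
    over.
  by rewrite sumr_const card_ord -[_ *+ r]mulr_natl mulrCA.
by rewrite /g !Edef.
Qed.

Let E_ell_almost_additive n k :
  `|E (ell 0 (n + k)) - E (ell 0 n) - E (ell 0 k)| <= g.
Proof.
rewrite -(E_ell_shift n k) -(E_defect n).
have sq2 := square_integrableD (ell_sq 0 (n + k)) (square_integrableZ (-1) (ell_sq 0 n)).
have sq3 := square_integrableD sq2 (square_integrableZ (-1) (ell_sq n k)).
have iZ f : square_integrable Pr f -> E (fun w => -1 * f w) = - E f.
  by move=> sf; rewrite /E RintegralZl ?mulN1r //; exact: square_integrable_integrable.
have -> : E (ell 0 (n + k)) - E (ell 0 n) - E (ell n k) =
  E (fun w => ell 0 (n + k) w + -1 * ell 0 n w + -1 * ell n k w).
  by rewrite !ED ?iZ //; exact: square_integrableZ.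
apply: (le_trans (le_normr_Rintegral _ _)) => //.
  exact: square_integrable_integrable.
apply: le_E.
- by apply: square_integrable_integrable; exact: square_integrable_norm.
- exact: square_integrable_integrable.
- by move=> w; rewrite !mulN1r; exact: ell_almost_additive.
Qed.

Lemma expected_rate : exists l, forall n, `|E (ell 0 n) - n%:R * l| <= g.
Proof. exact: almost_additive_linear E_ell_almost_additive. Qed.

(** * The centred log likelihood and its convergence *)

Section centred.
Variable l : R.
Hypothesis l_rate : forall n, `|E (ell 0 n) - n%:R * l| <= g.

(** The centring [N%:R * l] is additive in [N], so [Z] inherits almost additivity; the price is a
    mean bounded by [g] instead of zero. *)
Let Z a N (w : T) : R := ell a N w - N%:R * l.

Let Z_sq a N : square_integrable Pr (Z a N).
Proof. by apply: square_integrableD => //; exact: square_integrable_cst. Qed.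

Let E_Z a N : `|E (Z a N)| <= g.
Proof. by rewrite /Z ED // ?E_cst ?E_ell_shift //; exact: square_integrable_cst. Qed.

Let q N := E (fun w => Z 0 N w ^+ 2).

Let E_Z_sqr a N : (0 < N)%N -> E (fun w => Z a N w ^+ 2) = q N.
Proof.
move=> N0; apply: (@ell_shift_expectation (fun x => (x - N%:R * l) ^+ 2)) => //.
- by apply: measurable_funX; apply: measurable_funB.
- exact: (Z_sq 0 N).2.
- exact: (Z_sq a N).2.
Qed.

(** The two factors read disjoint blocks of [n] observations, so the expectation of the product is
    the product of two means bounded by [g]. *)
Let E_Z_cross n : (0 < n)%N -> E (fun w => Z 0 n w * Z n n w) <= g ^+ 2.
Proof.
case: n => // n _; pose F z := log_likelihood P mu beta z n.+1 - n.+1%:R * l.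
have F_local : depends_before (M := M) n F.
  by move=> z z' zz'; rewrite /F (log_likelihood_local P mu beta zz').
have mF : measurable_fun setT (fun x : blockType ('I_M * 'I_n.+1)%type R => F (block_obs x)).
  apply: measurable_funB => //; apply: measurable_log_likelihood.
  by move=> m j; exact: measurable_block_obs.
rewrite [leLHS](independent_expectation y_independent y_gaussian F_local F_local
  mF mF (Z_sq 0 n.+1) (Z_sq n.+1 n.+1)).
rewrite (le_trans (ler_norm _)) // normrM expr2.
by apply: ler_pM => //; exact: E_Z.
Qed.

Let eta := E (fun w => size_at 0 w ^+ 2).

Let E_size_sqr a : E (fun w => size_at a w ^+ 2) = eta.
Proof.
apply: (@size_shift_expectation (fun x => x ^+ 2)) => //.
- exact: (size_at_sq 0).2.
- exact: (size_at_sq a).2.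
Qed.

(** [err] bounds the error of doubling to [n + n + e] with [e <= 1]: the defect at [n], the size of
    the possible extra observation at time [n + n], and [|l|] for its centring. [K0] comes from
    bounding the square of a sum of three terms by three times the sum of their squares. *)
Let c := `|l| - ln delta.
Let err n w := 2 * (\sum_(j < r) size_at (n + j) w) + size_at (n + n) w + c.
Let K0 := 3 * (4 * (r%:R ^+ 2 * eta) + eta + c ^+ 2).

Let c_ge0 : 0 <= c.
Proof. by rewrite /c subr_ge0 (le_trans _ (normr_ge0 _)) // ln_le0. Qed.

Let err_sq n : square_integrable Pr (err n).
Proof.
apply: square_integrableD; last exact: square_integrable_cst.
apply: square_integrableD => //; apply: square_integrableZ.
exact: square_integrable_sum.
Qed.

Let E_err_sqr n : E (fun w => err n w ^+ 2) <= K0.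
Proof.
pose S w := \sum_(j < r) size_at (n + j) w.
have S_sq : square_integrable Pr S by exact: square_integrable_sum.
have ES : E (fun w => S w ^+ 2) <= r%:R ^+ 2 * eta.
  apply: (sqr_sum_expectation_le r (f := fun j => size_at (n + j))) => // j.
  by rewrite [leLHS]E_size_sqr.
have iS := S_sq.2; have isz := (size_at_sq (n + n)).2.
have ic : Pr.-integrable setT (EFin \o (fun=> c ^+ 2)) := (square_integrable_cst Pr c).2.
have i4S := integrable_realZ 4 iS.
have i4Ss := intD i4S isz; have iall := intD i4Ss ic.
apply: (@le_trans _ _ (E (fun w =>
  3 * (4 * S w ^+ 2 + size_at (n + n) w ^+ 2 + c ^+ 2)))).
  apply: le_E; [exact: (err_sq n).2|exact: integrable_realZ|].
  move=> w; rewrite /err -/(S w); move: (S w) (size_at _ w) => u v.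
  have := sqr_ge0 (2 * u - v); have := sqr_ge0 (2 * u - c); have := sqr_ge0 (v - c).
  by nra.
rewrite (EZi _ iall) (EDi i4Ss ic) (EDi i4S isz) (EZi _ iS) E_cst E_size_sqr /K0.
by rewrite ler_wpM2l // lerD2r lerD2r ler_wpM2l.
Qed.

Let Z_double e n w : (e <= 1)%N ->
  `|Z 0 (n + n + e) w - Z 0 n w - Z n n w| <= err n w.
Proof.
move=> e1; have := ell_almost_additive n n w; have := ell_increment (n + n) e w.
rewrite /err /c /defect /Z !natrD.
have s0 := size_at_ge0 (n + n) w; have l0 := ler_norm l; have l1 := ler_norm (- l).
rewrite normrN in l1.
case: e e1 => [|[|//]] _; rewrite ?big_ord0 ?big_ord1 ?addn0 ?addr0.
  by move=> _; rewrite !ler_norml => /andP[? ?]; apply/andP; split; lra.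
by rewrite !ler_norml => /andP[? ?] /andP[? ?]; apply/andP; split; lra.
Qed.

(** With [t] the error, [(u + v + t)^2 <= 5/4 (u + v)^2 + 5 t^2], since [(u + v - 4 t)^2 >= 0]. The
    mean of [(u + v)^2] is at most [2 q n + 2 g^2], so the factor becomes [5 / 2]. *)
Let q_double e n : (e <= 1)%N -> (0 < n)%N ->
  q (n + n + e) <= 5 / 2 * q n + (5 / 2 * g ^+ 2 + 5 * K0).
Proof.
move=> e1 n0.
have iX := (Z_sq 0 n).2; have iY := (Z_sq n n).2; have ie := (err_sq n).2.
have iXY := integrable_mul_square (Z_sq 0 n) (Z_sq n n).
have i1 := integrable_realZ 2 iXY; have i2 := intD iX iY; have i3 := intD i2 i1.
have i4 := integrable_realZ (5 / 4) i3; have i5 := integrable_realZ 5 ie.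
apply: (@le_trans _ _ (E (fun w =>
  5 / 4 * (Z 0 n w ^+ 2 + Z n n w ^+ 2 + 2 * (Z 0 n w * Z n n w)) + 5 * err n w ^+ 2))).
  apply: le_E; [exact: (Z_sq 0 (n + n + e)).2|exact: intD|].
  move=> w; have := Z_double n w e1.
  move: (Z 0 _ w) (Z 0 n w) (Z n n w) (err n w) => z u v b.
  rewrite ler_norml => /andP[b1 b2].
  have bd : (z - u - v) ^+ 2 <= b ^+ 2 by nra.
  by have := sqr_ge0 (u + v - 4 * (z - u - v)); nra.
rewrite (EDi i4 i5) (EZi _ i3) (EZi _ ie) (EDi i2 i1) (EDi iX iY) (EZi _ iXY).
rewrite (E_Z_sqr 0 n0) (E_Z_sqr n n0).
by have := E_Z_cross n0; have := E_err_sqr n; lra.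
Qed.

Lemma second_moment_growth : exists2 A, 0 <= A &
  forall N, (0 < N)%N -> q N <= A * (N%:R * Num.sqrt N%:R).
Proof.
apply: (@doubling_growth _ _ (5 / 2 * g ^+ 2 + 5 * K0)) => n n0.
  by rewrite mul2n -addnn -[(n + n)%N]addn0 q_double.
by rewrite mul2n -addnn -[(n + n).+1]addn1 q_double.
Qed.

Let Z_mean_sqr A N : (0 < N)%N -> q N <= A * (N%:R * Num.sqrt N%:R) ->
  E (fun w => (Z 0 N w / N%:R) ^+ 2) <= A / Num.sqrt N%:R.
Proof.
move=> N0 qN; have n0 : 0 < N%:R :> R by rewrite ltr0n.
have -> : (fun w => (Z 0 N w / N%:R) ^+ 2) = (fun w => N%:R ^- 2 * Z 0 N w ^+ 2).
  by apply/funext => w; rewrite exprMn exprVn mulrC.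
rewrite (EZi _ (Z_sq 0 N).2) ler_pdivrMl ?exprn_gt0 //; apply: (le_trans qN).
have s0 : 0 < Num.sqrt N%:R :> R by rewrite sqrtr_gt0.
move: s0 (sqr_sqrtr (ltW n0)); move: (Num.sqrt _) => s s0 <-.
rewrite le_eqVlt; apply/orP; left; apply/eqP.
by field; rewrite gt_eqF.
Qed.

Lemma centred_mean :
  (N%:R^-1%:E * \int[Pr]_w (ell 0 N w)%:E)%E @[N --> \oo] --> l%:E.
Proof.
rewrite [X in X @ _](_ : _ = EFin \o (fun N => N%:R^-1 * E (ell 0 N))); last first.
  apply/funext => N /=; rewrite EFinM fineK //.
  exact: (integrable_fin_num measurableT (square_integrable_integrable (ell_sq 0 N))).
apply: cvg_EFin => //; first exact: nearW.
apply/cvgrPdist_le => e e0; near=> N.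
have N0 : 0 < N%:R :> R by rewrite ltr0n; near: N; exact: nbhs_infty_gt.
rewrite /= (_ : _ - _ = - (N%:R^-1 * (E (ell 0 N) - N%:R * l))); last first.
  by field; rewrite gt_eqF.
rewrite normrN normrM normfV (gtr0_norm N0) ler_pdivrMl // (le_trans (l_rate N)) //.
by rewrite -ler_pdivrMr //; near: N; exact: nbhs_infty_ger.
Unshelve. all: by end_near.
Qed.

Lemma centred_probability eps : 0 < eps ->
  Pr [set w | eps <= `|N%:R^-1 * ell 0 N w - l|] @[N --> \oo] --> 0%E.
Proof.
move=> eps0; have [A A0 qA] := second_moment_growth.
pose u N : R := eps ^- 2 * (A / Num.sqrt N%:R).
have u0 : u N @[N --> \oo] --> (0 : R).
  apply/cvgr0Pnorm_le => e e0; near=> N.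
  have N0 : 0 < Num.sqrt N%:R :> R.
    by rewrite sqrtr_gt0 ltr0n; near: N; exact: nbhs_infty_gt.
  rewrite ger0_norm /u ?mulr_ge0 ?invr_ge0 ?exprn_ge0 ?sqrtr_ge0 ?(ltW eps0) //.
  rewrite mulrA ler_pdivrMr // -ler_pdivrMl //.
  have coef0 : 0 <= e^-1 * (eps ^- 2 * A).
    by rewrite !mulr_ge0 ?invr_ge0 ?exprn_ge0 ?(ltW e0) ?(ltW eps0).
  rewrite -(ger0_norm coef0) -sqrtr_sqr ler_sqrt ?ler0n //.
  by near: N; exact: nbhs_infty_ger.
apply: (@squeeze_cvge _ _ _ _ (cst 0%E) _ (EFin \o u)); last 2 first.
- exact: cvg_cst.
- apply: cvg_EFin u0; exact: nearW.
near=> N; rewrite measure_ge0 /=.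
have N0 : (0 < N)%N by near: N; exact: nbhs_infty_gt.
have n0 : N%:R != 0 :> R by rewrite pnatr_eq0 -lt0n.
have mZ : measurable_fun setT (fun w => Z 0 N w / N%:R).
  by apply: measurable_funM => //; exact: (Z_sq 0 N).1.
pose X : {RV Pr >-> R} :=
  HB.pack (fun w => Z 0 N w / N%:R) (isMeasurableFun.Build _ _ _ _ _ mZ).
have sX : square_integrable Pr X.
  by rewrite /X /=; under eq_fun do rewrite mulrC; exact: square_integrableZ.
have XE w : N%:R^-1 * ell 0 N w - l = X w by rewrite /X /Z /=; field.
rewrite [X in Pr X](_ : _ = [set w | (eps%:E <= `|(X w)%:E|)%E]); last first.
  by apply/seteqP; split => w /=; rewrite XE lee_fin.
have := @markov _ _ _ Pr X (fun x => x ^+ 2) eps eps0; rewrite unlock => chebyshev.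
rewrite /u EFinM lee_pdivlMl ?exprn_gt0 //; apply: (le_trans (chebyshev _ _ _)).
- exact: exprn_measurable.
- by move=> x _; exact: sqr_ge0.
- by move=> a b; rewrite !nnegrE => a0 b0; rewrite ler_sqr.
under eq_integral do rewrite /= real_normK ?num_real //.
rewrite -(fineK (integrable_fin_num measurableT sX.2)) lee_fin.
exact: Z_mean_sqr (qA _ N0).
Unshelve. all: by end_near.
Qed.

(** At fourth powers the bound [A / Num.sqrt N] becomes [A / j.+1 ^ 2], which is summable; [j.+1]
    keeps the denominators positive. *)
Let step j := (j.+1 ^ 4)%N.
Let gap_sum j w := \sum_(i < step j.+1 - step j) (size_at (step j + i) w + `|l|).

Let Z_gap j N w : (step j <= N)%N -> (N < step j.+1)%N ->
  `|Z 0 N w - Z 0 (step j) w| <= gap_sum j w.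
Proof.
move=> jN Nj; pose k := (N - step j)%N; have -> : N = (step j + k)%N by rewrite subnKC.
have kle : (k <= step j.+1 - step j)%N by rewrite leq_sub2r // ltnW.
apply: (@le_trans _ _ (\sum_(i < k) (size_at (step j + i) w + `|l|))).
  rewrite big_split /= sumr_const card_ord -[`|l| *+ k]mulr_natl.
  have := ell_increment (step j) k w.
  have : k%:R * l <= k%:R * `|l| by rewrite ler_wpM2l // ler_norm.
  have : k%:R * - l <= k%:R * `|l| by rewrite ler_wpM2l // -normrN ler_norm.
  rewrite /Z natrD !ler_norml => ? ? /andP[? ?].
  by apply/andP; split; lra.
rewrite /gap_sum -!(big_mkord xpredT (fun i => size_at (step j + i) w + `|l|)).
rewrite (big_cat_nat _ kle) //= lerDl sumr_ge0 // => i _.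
by rewrite addr_ge0.
Qed.

Let eta' := E (fun w => (size_at 0 w + `|l|) ^+ 2).

Let size_abs_sq a : square_integrable Pr (fun w => size_at a w + `|l|).
Proof. by apply: square_integrableD => //; exact: square_integrable_cst. Qed.

Let E_size_abs_sqr a : E (fun w => (size_at a w + `|l|) ^+ 2) = eta'.
Proof.
apply: (@size_shift_expectation (fun x => (x + `|l|) ^+ 2)) => //.
- by apply: measurable_funX; apply: measurable_funD.
- exact: (size_abs_sq 0).2.
- exact: (size_abs_sq a).2.
Qed.

Let gap_sum_sq j : square_integrable Pr (gap_sum j).
Proof. exact: square_integrable_sum. Qed.

Let gap_mean_sqr j :
  E (fun w => (gap_sum j w / (step j)%:R) ^+ 2) <= 225 * eta' * j.+1%:R ^- 2.
Proof.
have n0 : 0 < (step j)%:R :> R by rewrite ltr0n expn_gt0.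
have -> : (fun w => (gap_sum j w / (step j)%:R) ^+ 2) =
    (fun w => (step j)%:R ^- 2 * gap_sum j w ^+ 2).
  by apply/funext => w; rewrite exprMn exprVn mulrC.
rewrite (EZi _ (gap_sum_sq j).2) ler_pdivrMl ?exprn_gt0 //.
have eta0 : 0 <= eta' by apply: Rintegral_ge0 => w _; exact: sqr_ge0.
apply: (@le_trans _ _ ((step j.+1 - step j)%:R ^+ 2 * eta')).
  apply: (sqr_sum_expectation_le _ (f := fun i w => size_at (step j + i) w + `|l|)) => // i.
  by rewrite [leLHS]E_size_abs_sqr.
(* For [x >= 1], [(x + 1)^4 - x^4 = 4 x^3 + 6 x^2 + 4 x + 1] is at most [15 x^3]; hence the constant
   [225 = 15 ^ 2]. *)
have gap_le : (step j.+1 - step j)%:R <= 15 * j.+1%:R ^+ 3 :> R.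
  rewrite natrB ?leq_exp2r // /step !natrX -[j.+2%:R]natr1.
  have : 1 <= j.+1%:R :> R by rewrite ler1n.
  by move: j.+1%:R => x x1; nra.
apply: (@le_trans _ _ ((15 * j.+1%:R ^+ 3) ^+ 2 * eta')).
  by rewrite ler_wpM2r // ler_sqr ?nnegrE // mulr_ge0 ?exprn_ge0.
rewrite /step natrX; have : 0 < j.+1%:R :> R by rewrite ltr0n.
move: j.+1%:R => x x0; rewrite le_eqVlt; apply/orP; left; apply/eqP.
by field; rewrite gt_eqF.
Qed.

Lemma centred_ae : {ae Pr, forall w, N%:R^-1 * ell 0 N w @[N --> \oo] --> l}.
Proof.
have [A A0 qA] := second_moment_growth.
have E_summable (f : nat -> T -> R) (K : R) : 0 <= K ->
    (forall j, square_integrable Pr (f j)) ->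
    (forall j, E (fun w => f j w ^+ 2) <= K * j.+1%:R ^- 2) ->
    {ae Pr, forall w, f j w ^+ 2 @[j --> \oo] --> (0 : R)}.
  move=> K_ge0 sf fK; apply: (ae_cvg0_of_summable_integrals (C := K * 2)) => [j|j w|n].
  - by apply: measurable_funX; exact: (sf j).1.
  - exact: sqr_ge0.
  - under eq_bigr do rewrite -(fineK (integrable_fin_num measurableT (sf _).2)).
    rewrite sumEFin lee_fin; apply: (@le_trans _ _ (\sum_(j < n) K * j.+1%:R ^- 2)).
      by apply: ler_sum => j _; exact: fK.
    by rewrite -mulr_sumr ler_wpM2l // sum_inv_sqr_le.
have ae_Z : {ae Pr, forall w, (Z 0 (step j) w / (step j)%:R) ^+ 2 @[j --> \oo] --> (0 : R)}.
  apply: (E_summable _ A) => // j.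
    by under eq_fun do rewrite mulrC; exact: square_integrableZ.
  have step0 : (0 < step j)%N by rewrite expn_gt0.
  apply: (le_trans (Z_mean_sqr step0 (qA _ step0))).
  by rewrite /step (_ : 4 = 2 * 2)%N // expnM !natrX sqrtr_sqr ger0_norm ?exprn_ge0.
have ae_gap : {ae Pr, forall w, (gap_sum j w / (step j)%:R) ^+ 2 @[j --> \oo] --> (0 : R)}.
  have eta0 : 0 <= 225 * eta'.
    by rewrite pmulr_rge0 //; apply: Rintegral_ge0 => w _; exact: sqr_ge0.
  have gap_sq j : square_integrable Pr (fun w => gap_sum j w / (step j)%:R).
    by under eq_fun do rewrite mulrC; exact: square_integrableZ.
  exact: E_summable eta0 gap_sq gap_mean_sqr.
apply: filterS2 ae_Z ae_gap => w Zw gapw.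
have := subsequence_cvg0 (z := fun N => Z 0 N w) (fun j N => @Z_gap j N w) Zw gapw.
move=> /cvgr0Pnorm_le Z0; apply/cvgrPdist_le => e e0; near=> N.
have N0 : N%:R != 0 :> R by rewrite pnatr_eq0 -lt0n; near: N; exact: nbhs_infty_gt.
rewrite (_ : _ - _ = - (N%:R^-1 * Z 0 N w)); last by rewrite /Z; field.
by rewrite normrN; near: N; exact: Z0.
Unshelve. all: by end_near.
Qed.

End centred.
End rate.

Theorem proposition1 (R : realType) (M : nat) (P : 'M[R]_M) (mu : 'cV[R]_M)
    (beta : R) (d : measure_display) (T : measurableType d)
    (Pr : probability T R) (y : 'I_M -> nat -> {RV Pr >-> R})
    (P_stochastic : stochastic_matrix P)
    (P_irreducible : irreducible_chain P)
    (P_aperiodic : aperiodic_chain P)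
    (mu_stationary : stationary_distribution P mu)
    (beta_gt0 : 0 < beta)
    (y_independent : mutually_independent
       [set mn : 'I_M * nat | (1 <= mn.2)%N] (fun mn => y mn.1 mn.2))
    (y_gaussian : forall (m : 'I_M) (n : nat),
       (1 <= n)%N -> standard_gaussian (y m n)) :
  let logL (N : nat) (w : T) : R :=
    ln (likelihood_ratio P mu beta (fun m n => y m n w) N) in
  exists kappa : R,
    [/\ ((N%:R^-1)%:E * 'E_Pr[logL N])%E @[N --> \oo] --> (- kappa)%:E,
        {ae Pr, forall w, N%:R^-1 * logL N w @[N --> \oo] --> - kappa}
      & cvg_in_probability Pr (fun N w => N%:R^-1 * logL N w) (- kappa)].
Proof.
move=> logL.
have [r [delta [delta0 delta1 Pdelta]]] :=
  primitive_power P_stochastic.1 P_irreducible P_aperiodic.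
have [l l_rate] := expected_rate P_stochastic mu_stationary beta_gt0
  y_independent y_gaussian delta0 delta1 Pdelta.
(* The equality can fail at [N = 0], so each limit below is transferred along eventual equality. *)
have logLE N w : (0 < N)%N -> logL N w = log_likelihood P mu beta (obs y 0 w) N.
  by move=> N0; rewrite /logL ln_likelihood_ratioE.
exists (- l); rewrite opprK; split.
- apply: cvg_trans (centred_mean P_stochastic mu_stationary beta_gt0
    y_gaussian l_rate).
  apply: near_eq_cvg; near=> N; rewrite unlock; congr (_ * _)%E.
  apply: eq_integral => w _; rewrite logLE //.
  by near: N; exact: nbhs_infty_gt.
- have := centred_ae P_stochastic mu_stationary beta_gt0 y_independent
    y_gaussian delta0 delta1 Pdelta l_rate.
  apply: filterS => w; apply: cvg_trans; apply: near_eq_cvg; near=> N.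
  by rewrite logLE //; near: N; exact: nbhs_infty_gt.
- move=> eps eps0; apply: cvg_trans (centred_probability P_stochastic mu_stationary
    beta_gt0 y_independent y_gaussian delta0 delta1 Pdelta l_rate eps0).
  apply: near_eq_cvg; near=> N; congr (Pr _); apply/seteqP.
  by split=> w /=; rewrite logLE //; near: N; exact: nbhs_infty_gt.
Unshelve. all: by end_near.
Qed.
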